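(* Let $M$ be a finite matroid without loops or coloops, with ground set $E$, and let $\mathcal P$ be a condensation of $M$ with incidence matrix $A_{\mathcal P}$. Let $\Phi$ be a valuative matroid invariant with values in an abelian group. Then $$\Phi(M)=\sum_{\hat 0=B_0<\cdots<B_k=\hat 1}\left(\prod_{i=1}^{k}-(A_{\mathcal P}^{-1})_{B_{i-1},B_i}\right)\Phi(\mathrm{Sch}_{\mathbf B}),$$ where the sum is over all strict block chains $\mathbf B=(\hat 0=B_0<B_1<\cdots<B_k=\hat 1)$ in $\mathcal P$ (of all lengths $k$). The condensed configuration therefore gives the Schubert coordinates of $M$ after isomorphic Schubert matroids are identified.
   Context: A flat $X$ of $M$ is cyclic if the restriction $M|X$ has no coloops. $\mathcal Z(M)$ denotes the lattice of cyclic flats of $M$, ordered by inclusion; since $M$ has no loops or coloops, $\varnothing$ and $E$ are cyclic flats. Condensed configuration: a condensation of $M$ is a partition $\mathcal P$ of the set $\mathcal Z(M)$ into blocks such that all flats in a block have the same rank and the same cardinality, and such that for any two blocks $B,C\in\mathcal P$ every flat $Y\in C$ contains the same number of flats from $B$. This common number is $A_{\mathcal P}(B,C)=\#\{X\in B\mid X\subseteq Y\}$ for $Y\in C$. For $X\in B$ write $s_B=|X|$ and $\rho_B=\mathrm{rk}(X)$. The condensed configuration is the data of the labels $(s_B,\rho_B)$ and the numbers $A_{\mathcal P}(B,C)$. The matrix $A_{\mathcal P}=(A_{\mathcal P}(B,C))_{B,C\in\mathcal P}$ is upper unitriangular when blocks are ordered by rank, so it is invertible over $\mathbb Z$. Write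 $B\le C$ when $A_{\mathcal P}(B,C)>0$; this is a partial order on $\mathcal P$. Put $\hat 0=\{\varnothing\}$ and $\hat 1=\{E\}$ (these are blocks of $\mathcal P$). Schubert matroids: a Schubert matroid is a matroid whose lattice of cyclic flats is a chain. Such a matroid without loops or coloops is determined up to isomorphism by the cardinalities and ranks of its cyclic flats. For a strict block chain $\mathbf B=(\hat 0=B_0<\cdots<B_k=\hat 1)$, $\mathrm{Sch}_{\mathbf B}$ denotes the Schubert matroid, unique up to isomorphism, on a ground set of size $|E|$ whose cyclic flats form a chain $F_0\subset F_1\subset\cdots\subset F_k$ with $|F_i|=s_{B_i}$ and $\mathrm{rk}(F_i)=\rho_{B_i}$ for $0\le i\le k$ (so $F_0=\varnothing$ and $F_k$ is the whole ground set). Valuative invariants: for a matroid $N$ on a finite set $E$, the base polytope $P(N)\subset\mathbb R^E$ is the convex hull of the indicator vectors of the bases of $N$. A function $\Phi$ from matroids on a fixed finite set to an abelian group is a valuation if $\sum_i a_i\Phi(N_i)=0$ whenever finitely many matroids $N_i$ on that set and $a_i\in\mathbb Z$ satisfy $\sum_i a_i\mathbf 1_{P(N_i)}=0$, where $\mathbf 1$ denotes the indicator function. A valuative matroid invariant is an isomorphism-invariant function on finite matroids whose restriction to the matroids on every fixed ground set is a valuation. Schubert coordinates: the Schubert coordinates of $M$ after identifying isomorphic Schubert matroids are the integer coefficients expressing the class of $M$ as an integer linear combination of classes of Schubert matroids in the abelian group generated by isomorphism classes of matroids modulo all relations $\sum_i a_i[N_i]=0$ coming from identities $\sum_i a_i\mathbf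 1_{P(N_i)}=0$ on a fixed ground set. The last sentence of the claim says that the displayed formula computes these from the condensed configuration: the coordinate at the class of a Schubert matroid $S$ is the sum of $\prod_{i=1}^k -(A_{\mathcal P}^{-1})_{B_{i-1},B_i}$ over all strict block chains $\mathbf B$ with $\mathrm{Sch}_{\mathbf B}\cong S$. *)

(* Defs.v *)
From HB Require Import structures.
From mathcomp Require Import all_boot all_order all_algebra.
From mathcomp Require Import boolp classical_sets functions reals numfun.

Set Implicit Arguments.
Unset Strict Implicit.
Unset Printing Implicit Defensive.

Import Order.TTheory GRing.Theory Num.Theory.

Local Open Scope ring_scope.

Record matroid (T : finType) := Matroid {
  bases : {set {set T}};
  bases_neq0 : bases != finset.set0;
  bases_exchange : forall B1 B2 : {set T}, B1 \in bases -> B2 \in bases ->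
    forall x, x \in B1 :\: B2 ->
    exists2 y, y \in B2 :\: B1 & y |: (B1 :\ x) \in bases }.

Section Matroid.
Variables (T : finType) (M : matroid T).
Implicit Types (X I : {set T}) (e : T).

Definition indep I : bool := [exists B in bases M, I \subset B].

Definition rank X : nat := (\max_(I : {set T} | indep I && (I \subset X)) #|I|)%N.

Definition loop e : bool := [forall B in bases M, e \notin B].
Definition coloop e : bool := [forall B in bases M, e \in B].

Definition flat X : bool := [forall e, (e \notin X) ==> (rank X < rank (e |: X))%N].

(* The bases of M|X.  M|X itself, whose ground set is X, is not built. *)
Definition restr_bases X : {set {set T}} :=
  [set I : {set T} | maxset (fun J : {set T} => indep J && (J \subset X)) I]%SET.

Definition restr_coloop X e : bool :=
  (e \in X) && [forall B in restr_bases X, e \in B].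

Definition cyclic_flats : {set {set T}} :=
  [set X : {set T} | flat X && [forall e, ~~ restr_coloop X e]]%SET.

Record condensation (P : {set {set {set T}}}) : Prop := Condensation {
  cond_partition : finset.partition P cyclic_flats;
  cond_rank : forall B X Y, B \in P -> X \in B -> Y \in B -> rank X = rank Y;
  cond_card : forall B X Y, B \in P -> X \in B -> Y \in B -> #|X| = #|Y|;
  cond_inc : forall B C Y Y', B \in P -> C \in P -> Y \in C -> Y' \in C ->
    #|[set X in B | X \subset Y]%SET| = #|[set X in B | X \subset Y']%SET| }.

Lemma indep0 : indep finset.set0.
Proof.
have /finset.set0Pn[B BM] := bases_neq0 M.
by apply/existsP; exists B; rewrite BM finset.sub0set.
Qed.

Lemma bases_restrT B : B \in bases M -> B \in restr_bases [set: T].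
Proof.
move=> BM; rewrite inE; apply/maxsetP; split.
  by rewrite finset.subsetT andbT; apply/existsP; exists B; rewrite BM subxx.
move=> I /andP[/existsP[B' /andP[B'M sIB']] _] sBI.
apply/eqP; rewrite finset.eqEsubset sBI andbT; apply: (fintype.subset_trans sIB').
apply/fintype.subsetP => x xB'; apply/negPn/negP => xB.
have xD : x \in B' :\: B by rewrite inE xB.
have [y + _] := bases_exchange B'M BM xD.
by rewrite inE => /andP[/negP yB' yB]; case: yB'; apply: (fintype.subsetP sIB');
   apply: (fintype.subsetP sBI).
Qed.

Hypothesis Ml : forall e, ~~ loop e.
Hypothesis Mc : forall e, ~~ coloop e.

Lemma cyclic_flat0 : finset.set0 \in cyclic_flats.
Proof.
rewrite inE; apply/andP; split; last first.
  by apply/forallP => e; rewrite /restr_coloop inE.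
apply/forallP => e; apply/implyP => _.
have -> : rank finset.set0 = 0%N.
  apply/eqP; rewrite -leqn0; apply/bigmax_leqP => I /andP[_].
  by rewrite finset.subset0 => /eqP->; rewrite cards0.
have := Ml e; rewrite negb_forall_in => /existsP[B /andP[BM]]; rewrite negbK => eB.
rewrite (leq_trans _ (@leq_bigmax_cond _ _ _ [set e]%SET _)) ?cards1 //.
rewrite finset.setU0 subxx andbT; apply/existsP; exists B.
by rewrite BM finset.sub1set.
Qed.

Lemma cyclic_flatT : [set: T] \in cyclic_flats.
Proof.
rewrite inE; apply/andP; split.
  by apply/forallP => e; rewrite inE.
apply/forallP => e; rewrite /restr_coloop inE /=; apply/negP => /forallP eP.
have /negP := Mc e; apply; apply/forallP => B; apply/implyP => /bases_restrT BT.
by have /implyP := eP B; apply.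
Qed.

Variables (P : {set {set {set T}}}) (HP : condensation P).

(* The block of P containing X is the singleton of X as soon as X is the only
   set of its cardinality. *)
Lemma set1_block X : X \in cyclic_flats ->
  (forall Y : {set T}, #|Y| = #|X| -> Y = X) -> [set X]%SET \in P.
Proof.
move=> XZ XU; have /and3P[/eqP covP _ _] := cond_partition HP.
move: XZ; rewrite -covP => /finset.bigcupP[B BP XB].
suff <- : B = [set X]%SET by [].
apply/finset.setP => Y; rewrite inE; apply/idP/eqP => [YB|->//].
exact: XU (cond_card HP BP YB XB).
Qed.

Lemma hat0_block : [set finset.set0]%SET \in P.
Proof.
apply: set1_block cyclic_flat0 _ => Y.
by rewrite cards0 => /cards0_eq.
Qed.

Lemma hat1_block : [set [set: T]]%SET \in P.
Proof.
apply: set1_block cyclic_flatT _ => Y cY.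
by apply/eqP; rewrite eqEcard finset.subsetT cY leqnn.
Qed.

End Matroid.

(* The blocks hat0 and hat1 are determined by the labels; they are stored only
   for convenience. *)
Record condensed_configuration := CondensedConfiguration {
  block : finType;
  bsize : block -> nat;
  brank : block -> nat;
  binc : block -> block -> nat;
  hat0 : block;
  hat1 : block }.

Section ConfigurationOf.
Variables (T : finType) (M : matroid T) (P : {set {set {set T}}}).
Hypotheses (Ml : forall e, ~~ loop M e) (Mc : forall e, ~~ coloop M e).
Hypothesis HP : condensation M P.

(* Blocks are nonempty, so the default value is never used; by the definition
   of a condensation, the labels do not depend on the representative. *)
Definition block_repr (B : {set {set T}}) : {set T} :=
  odflt finset.set0 [pick X in B].

Definition configuration_of : condensed_configuration :=
  @CondensedConfiguration {B : {set {set T}} | B \in P}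
    (fun B => #|block_repr (val B)|)
    (fun B => rank M (block_repr (val B)))
    (fun B C => #|[set X in val B | X \subset block_repr (val C)]%SET|)
    (exist (fun B => B \in P) _ (hat0_block Ml HP))
    (exist (fun B => B \in P) _ (hat1_block Mc HP)).

End ConfigurationOf.

HB.instance Definition _ (T : finType) := gen_eqMixin (matroid T).
HB.instance Definition _ (T : finType) := gen_choiceMixin (matroid T).

Definition isomorphic (T U : finType) (M : matroid T) (N : matroid U) : Prop :=
  exists f : T -> U, bijective f /\
    forall B : {set T}, ((f @: B)%SET \in bases N) = (B \in bases M).

Definition schubert (T : finType) (N : matroid T) : Prop :=
  forall X Y, X \in cyclic_flats N -> Y \in cyclic_flats N ->
    (X \subset Y) || (Y \subset X).

Section FreeMatroid.
Variable T : finType.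

Lemma free_bases_neq0 : [set [set: T]]%SET != finset.set0.
Proof. by apply/finset.set0Pn; exists [set: T]; rewrite inE. Qed.

Lemma free_bases_exchange (B1 B2 : {set T}) :
  B1 \in [set [set: T]]%SET -> B2 \in [set [set: T]]%SET ->
  forall x, x \in B1 :\: B2 ->
  exists2 y, y \in B2 :\: B1 & y |: (B1 :\ x) \in [set [set: T]]%SET.
Proof. by rewrite !inE => /eqP-> /eqP-> x; rewrite finset.setDv inE. Qed.

Definition free_matroid : matroid T :=
  Matroid free_bases_neq0 free_bases_exchange.

End FreeMatroid.

(* The matroids on the standard ground sets.  Every finite matroid is isomorphic
   to one of these, so they represent all isomorphism classes; unlike the type
   of all finite matroids, fmatroid is small enough to index a zmodType. *)
Record fmatroid := FMatroid { fsize : nat; to_matroid :> matroid 'I_fsize }.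

Section Configuration.
Variable K : condensed_configuration.

Definition inc_mx : 'M[int]_#|block K| :=
  \matrix_(i, j) (binc (enum_val i) (enum_val j))%:Z.

Definition inv_inc (B C : block K) : int :=
  invmx inc_mx (enum_rank B) (enum_rank C).

Definition block_lt (B C : block K) : bool := (B != C) && (0 < binc B C)%N.

Section Chain.
Variables (k : nat) (B : {ffun 'I_k.+1 -> block K}).

Definition block_chain : bool :=
  [&& B ord0 == hat0 K, B ord_max == hat1 K &
      [forall i : 'I_k, block_lt (B (widen_ord (leqnSn k) i)) (B (lift ord0 i))]].

Definition chain_coeff : int :=
  \prod_(i < k) - inv_inc (B (widen_ord (leqnSn k) i)) (B (lift ord0 i)).

(* The ground set has |E| elements, since |E| is the size label of hat1. *)
Definition is_Sch (S : matroid 'I_(bsize (hat1 K))) : Prop :=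
  exists F : 'I_k.+1 -> {set 'I_(bsize (hat1 K))},
    [/\ forall X, X \in cyclic_flats S <-> exists i, X = F i,
        forall i j : 'I_k.+1, (i < j)%N -> F i \proper F j
      & forall i, #|F i| = bsize (B i) /\ rank S (F i) = brank (B i)].

(* The choice is unique up to isomorphism; the default value free_matroid is
   not used when B is a block chain of a condensation. *)
Definition Sch : matroid 'I_(bsize (hat1 K)) := xget (free_matroid _) is_Sch.

End Chain.

(* Since block_lt is a strict partial order on the blocks of a condensation,
   a chain B_0 < ... < B_k has k < #|block K|, so the sum below runs over the
   block chains of all lengths. *)
Definition schubert_coeff (S : fmatroid) : int :=
  \sum_(k < #|block K|) \sum_(B : {ffun 'I_k.+1 -> block K} |
      block_chain B && `[< isomorphic (Sch B) S >]) chain_coeff B.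

End Configuration.

Section Valuative.
Variable R : realType.

Definition indicator_vector (T : finType) (B : {set T}) : {ffun T -> R} :=
  [ffun e => (e \in B)%:R].

Definition base_polytope (T : finType) (N : matroid T) : set {ffun T -> R} :=
  fun x => exists w : {set T} -> R,
    [/\ forall B, B \in bases N -> 0 <= w B,
        \sum_(B in bases N) w B = 1
      & forall e, x e = \sum_(B in bases N) w B * indicator_vector B e].

Definition polytope_relation (T : finType) (n : nat)
    (N : 'I_n -> matroid T) (a : 'I_n -> int) : Prop :=
  forall x : {ffun T -> R}, \sum_(i < n) a i * \1_(base_polytope (N i)) x = 0.

Record valuative_invariant (A : zmodType)
    (Phi : forall T : finType, matroid T -> A) : Prop := {
  vinv_iso : forall (T U : finType) (M : matroid T) (N : matroid U),
    isomorphic M N -> Phi T M = Phi U N;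
  vinv_val : forall (T : finType) (n : nat)
    (N : 'I_n -> matroid T) (a : 'I_n -> int),
    polytope_relation N a -> \sum_(i < n) Phi T (N i) *~ a i = 0 }.

(* The subgroup generated by G. *)
Inductive zspan (V : zmodType) (G : set V) : V -> Prop :=
| zspan0 : zspan G 0
| zspan_gen v : G v -> zspan G v
| zspanB u v : zspan G u -> zspan G v -> zspan G (u - v).

(* The free abelian group on the isomorphism classes of matroids is realized
   inside fmatroid -> int: the generator at the class of N is the function that
   is 1 on the matroids isomorphic to N and 0 elsewhere.  The value at N of an
   element of that group is thus its coefficient at the class of N. *)
Definition iso_class (T : finType) (N : matroid T) : fmatroid -> int :=
  fun N' => `[< isomorphic N N' >]%:R.

Definition valuative_relator (r : fmatroid -> int) : Prop :=
  exists (T : finType) (n : nat) (N : 'I_n -> matroid T) (a : 'I_n -> int),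
    polytope_relation N a /\ r = \sum_(i < n) iso_class (N i) *~ a i.

Definition schubert_class (s : fmatroid -> int) : Prop :=
  exists (T : finType) (S : matroid T), schubert S /\ s = iso_class S.

(* c, an integer combination of classes of Schubert matroids, equals the class
   of M modulo the valuative relations. *)
Definition schubert_coordinates (T : finType) (M : matroid T)
    (c : fmatroid -> int) : Prop :=
  zspan schubert_class c /\ zspan valuative_relator (iso_class M - c).

End Valuative.

(* Main.v *)
From HB Require Import structures.
Require Import Defs.
From mathcomp Require Import boolp classical_sets functions reals numfun.
From mathcomp Require Import filter topology normedtype derive.
From mathcomp Require Import all_boot all_order all_algebra perm fingroup.
From mathcomp Require Import zify lra ring.

Set Implicit Arguments.
Unset Strict Implicit.
Unset Printing Implicit Defensive.

Import Order.TTheory GRing.Theory Num.Theory.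
Import numFieldTopology.Exports numFieldNormedType.Exports.

Local Open Scope ring_scope.

(** The base polytope of a matroid consists of the points [x] of a hypersimplex with
    [x(F) <= rank F] for all cyclic flats [F] ([base_polytopeP]).  A chain of cyclic flats
    of [M] from the empty set to the ground set is the lattice of cyclic flats of a
    Schubert matroid that has the ranks of [M] on the chain ([cyclic_flats_chain],
    [rank_chain_matroid]); its polytope is cut out of the same hypersimplex by the
    inequalities of the flats in the chain.  So a point [x] lies in the polytopes of the
    chains that avoid the flats violated by [x].

    Give a chain the weight [prod_i - mu(F_(i-1), F_i)], where [mu] is the Mobius
    function of the lattice of cyclic flats.  If [x] violates no flat, the weights sum
    to the entry at (empty set, ground set) of the inverse of [mu], which is 1.  If [x]
    violates some flat, the sum over the chains of non-violated flats is 0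
    ([signed_chain_count]): the slack [rank F - x(F)] is submodular, and so the meet of
    a violated flat with a most violated one is violated again.  Hence the indicator
    function of the polytope of [M] is the weighted sum of those of the Schubert
    matroids of its chains ([flat_chain_relation]).

    For a condensation, the sum of [mu(X, Y)] over the flats [X] of a block [B] is the
    entry of the inverse incidence matrix at [B] and the block of [Y]
    ([sum_mobius_block]).  So the weights of the chains of flats running through given
    blocks sum to the coefficient of the block chain ([sum_flat_chain_coeff]), and the
    Schubert matroids of these chains are all isomorphic, because a Schubert matroid
    is determined by the sizes and ranks of its cyclic flats ([schubert_isomorphic]).
    This gives the formula for [Phi], and, as the same identity holds for isomorphism
    classes, shows that its coefficients are Schubert coordinates.

    They are the only ones because classes of Schubert matroids are linearly
    independent ([schubert_independent]).  For a complete flag [X] of subsets, the part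
    of the base polytope where [x(X_k) >= s_k] for all [k] is compact and convex, and
    nonempty exactly when [rank X_k >= s_k] for all [k]; since the Euler characteristic
    is additive on linear relations between indicator functions of compact convex
    sets ([euler_characteristic]), the number of flags with prescribed ranks is a
    valuative invariant ([flags_valuative]).  A Schubert matroid has an order along which
    all initial segments have the least possible rank ([adapted_rank]), and these ranks
    determine it ([profile_isomorphic]); so these invariants separate the classes of
    Schubert matroids, in a triangular way. *)

(** * Ranks and cyclic flats *)

Section Rank.
Variables (T : finType) (M : matroid T).
Implicit Types (X Y I J B : {set T}) (e : T).

(** By induction on [#|B1 :\: B2|]: an exchange moves [B1] closer to [B2] and keeps its
    size. *)
Lemma bases_card B1 B2 : B1 \in bases M -> B2 \in bases M -> #|B1| = #|B2|.
Proof.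
have [n] := ubnP #|B1 :\: B2|; elim: n B1 => // n IHn B1 ltn B1M B2M.
have [D0|[x xD]] := set_0Vmem (B1 :\: B2).
  have [D0'|[x xD]] := set_0Vmem (B2 :\: B1).
    congr #|pred_of_set _|; apply/eqP; rewrite eqEsubset.
    by rewrite -!setD_eq0 D0 D0' eqxx.
  by have [y] := bases_exchange B2M B1M xD; rewrite D0 inE.
have [y yD B'M] := bases_exchange B1M B2M xD.
move: (xD) (yD); rewrite !inE => /andP[xB2 xB1] /andP[yB1 yB2].
have <- : #|y |: B1 :\ x| = #|B1|.
  by rewrite cardsU1 !inE (negPf yB1) andbF add1n [RHS](cardsD1 x) xB1.
apply: IHn => //; move: ltn; rewrite ltnS (cardsD1 x) xD add1n.
apply: leq_trans; rewrite ltnS; apply/subset_leq_card/subsetP => z.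
rewrite !inE => /andP[zB2 /orP[/eqP zy|/andP[-> ->]]]; last by rewrite zB2.
by rewrite zy yB2 in zB2.
Qed.

Lemma bases_indep B : B \in bases M -> indep M B.
Proof. by move=> BM; apply/existsP; exists B; rewrite BM subxx. Qed.

Lemma indepS I J : I \subset J -> indep M J -> indep M I.
Proof.
move=> sIJ /existsP[B /andP[BM sJB]]; apply/existsP; exists B.
by rewrite BM (subset_trans sIJ).
Qed.

(** A base containing [I] with the fewest elements outside [I :|: B] has none:
    such an element could be exchanged for one of [B]. *)
Lemma indep_extend I B : indep M I -> B \in bases M ->
  exists2 B', B' \in bases M & (I \subset B') && (B' \subset I :|: B).
Proof.
move=> /existsP[B0 /andP[B0M sIB0]] BM.
have [n] := ubnP #|B0 :\: (I :|: B)|; elim: n B0 B0M sIB0 => // n IHn B0 B0M sIB0 ltn.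
have [/eqP|[z zD]] := set_0Vmem (B0 :\: (I :|: B)).
  by rewrite setD_eq0 => sB0; exists B0 => //; rewrite sIB0.
move: (zD); rewrite !inE negb_or => /andP[/andP[zI zB] zB0].
have /(bases_exchange B0M BM)[y yD B'M] : z \in B0 :\: B by rewrite inE zB.
move: yD; rewrite inE => /andP[yB0 yB].
apply: (IHn _ B'M).
  apply/subsetP => t tI; rewrite !inE (subsetP sIB0) // andbT.
  by apply/orP; right; apply: contraNneq zI => <-.
move: ltn; rewrite ltnS (cardsD1 z) zD add1n.
apply: leq_trans; rewrite ltnS; apply/subset_leq_card/subsetP => t.
rewrite !inE => /andP[tIB /orP[/eqP ty|/andP[-> ->]]]; last by rewrite tIB.
by rewrite ty yB orbT in tIB.
Qed.

(** Extend [I] to a base inside the union of [I] and a base containing [J]; if that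
    base missed [J :\: I], it would be too small. *)
Lemma indep_augment I J : indep M I -> indep M J -> (#|I| < #|J|)%N ->
  exists2 e, e \in J :\: I & indep M (e |: I).
Proof.
move=> iI /existsP[B /andP[BM sJB]] ltIJ.
have [B' B'M /andP[sIB' sB']] := indep_extend iI BM.
have [/eqP|[e eD]] := set_0Vmem (B' :&: (J :\: I)).
  rewrite setI_eq0 => dis.
  have : B' \subset I :|: (B :\: J).
    apply/subsetP => t tB'; have := subsetP sB' _ tB'; rewrite !inE.
    have := disjointFr dis tB'; rewrite !inE.
    by case: (t \in I) => //=; case: (t \in J).
  move=> /subset_leq_card; have [+ _] := leq_card_setU I (B :\: J).
  have := cardsID J B; rewrite (setIidPr sJB) (bases_card B'M BM).
  by move: ltIJ; clear; lia.
move: eD; rewrite !inE => /and3P[eB' eI eJ]; exists e; first by rewrite inE eI.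
by apply: indepS (bases_indep B'M); rewrite subUset sub1set eB'.
Qed.

Lemma card_le_rank I X : indep M I -> I \subset X -> (#|I| <= rank M X)%N.
Proof. by move=> iI sIX; apply: leq_bigmax_cond; rewrite iI. Qed.

Lemma rank_leP X n :
  reflect (forall I, indep M I -> I \subset X -> (#|I| <= n)%N) (rank M X <= n)%N.
Proof.
rewrite /rank; apply: (iffP (bigmax_leqP _ _ _)) => [le I iI sIX|le I /andP[]]; last exact: le.
by apply: le; rewrite iI.
Qed.

Lemma rank_basis X : exists I, [/\ indep M I, I \subset X & #|I| = rank M X].
Proof.
have : (0 < #|[pred I : {set T} | indep M I && (I \subset X)]|)%N.
  by apply/card_gt0P; exists set0; rewrite inE indep0 sub0set.
by case/(eq_bigmax_cond (fun I : {set T} => #|I|)) => I /andP[iI sIX] eI; exists I.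
Qed.

Lemma indep_extend_rank I X : indep M I -> I \subset X ->
  exists J, [/\ indep M J, I \subset J, J \subset X & #|J| = rank M X].
Proof.
have [J0 [iJ0 sJ0 cJ0]] := rank_basis X.
have [n] := ubnP (rank M X - #|I|)%N; elim: n I => // n IHn I ltn iI sIX.
have := card_le_rank iI sIX; rewrite leq_eqVlt => /orP[/eqP eI|lt].
  by exists I.
have [|e] := indep_augment iI iJ0; first by rewrite cJ0.
rewrite inE => /andP[eI eJ] ie.
have [||J [iJ sJ sJX cJ]] := IHn (e |: I) _ ie.
- by rewrite cardsU1 eI; lia.
- by rewrite subUset sub1set sIX (subsetP sJ0).
by exists J; split=> //; apply: subset_trans sJ; apply: subsetUr.
Qed.

Lemma rankS X Y : X \subset Y -> (rank M X <= rank M Y)%N.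
Proof.
move=> sXY; apply/rank_leP => I iI sIX.
by apply: card_le_rank (subset_trans sIX sXY).
Qed.

Lemma rank_card X : (rank M X <= #|X|)%N.
Proof. by apply/rank_leP => I _; apply: subset_leq_card. Qed.

Lemma rank0 : rank M set0 = 0%N.
Proof. by apply/eqP; rewrite -leqn0 -(cards0 T) rank_card. Qed.

Lemma indep_rank I : indep M I = (#|I| <= rank M I)%N.
Proof.
apply/idP/idP => [iI|]; first exact: card_le_rank.
have [J [iJ sJ <-]] := rank_basis I => leI.
by have /eqP<- : J == I by rewrite eqEcard sJ.
Qed.

Lemma rank_submod X Y :
  (rank M (X :|: Y) + rank M (X :&: Y) <= rank M X + rank M Y)%N.
Proof.
have [I [iI sI <-]] := rank_basis (X :&: Y).
have sIU : I \subset X :|: Y by apply: subset_trans sI _; apply/subIset; rewrite subsetUl.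
have [J [iJ sIJ sJ <-]] := indep_extend_rank iI sIU.
have leX : (#|J :&: X| <= rank M X)%N.
  by apply: card_le_rank (subsetIr _ _); apply: indepS iJ; apply: subsetIl.
have leY : (#|J :&: Y| <= rank M Y)%N.
  by apply: card_le_rank (subsetIr _ _); apply: indepS iJ; apply: subsetIl.
have leI : (#|I| <= #|(J :&: X) :&: (J :&: Y)|)%N.
  by rewrite subset_leq_card // -setIIr subsetI sIJ sI.
have := cardsUI (J :&: X) (J :&: Y); rewrite -setIUr (setIidPl sJ).
by lia.
Qed.

Lemma rank_setD X Y : (rank M X <= rank M (X :&: Y) + #|X :\: Y|)%N.
Proof.
have := rank_submod (X :&: Y) (X :\: Y); rewrite setID.
by have := rank_card (X :\: Y); lia.
Qed.

(** The gain of rank from adding a point only decreases as the set grows. *)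
Lemma rankU1_submod e X Y : X \subset Y -> rank M (e |: X) = rank M X ->
  rank M (e |: Y) = rank M Y.
Proof.
move=> sXY eX; apply/eqP; rewrite eqn_leq (rankS (subsetUr _ _)) andbT.
have := rank_submod (e |: X) Y; rewrite -setUA (setUidPr sXY) eX.
have : (rank M X <= rank M ((e |: X) :&: Y))%N.
  by apply: rankS; rewrite subsetI subsetUr.
by lia.
Qed.

Lemma basesE B : (B \in bases M) = indep M B && (#|B| == rank M setT).
Proof.
have rE B' : B' \in bases M -> #|B'| = rank M setT.
  move=> B'M; apply/eqP; rewrite eqn_leq card_le_rank ?subsetT ?bases_indep //=.
  apply/rank_leP => I /existsP[B2 /andP[B2M sI]] _.
  by rewrite (bases_card B'M B2M) subset_leq_card.
apply/idP/andP => [BM|[/existsP[B' /andP[B'M sB]] /eqP cB]].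
  by rewrite bases_indep // rE.
by have /eqP-> : B == B' by rewrite eqEcard sB cB rE /=.
Qed.

Lemma card_base B : B \in bases M -> #|B| = rank M setT.
Proof. by rewrite basesE => /andP[_ /eqP]. Qed.

Lemma card_baseI B X : B \in bases M -> (#|B :&: X| <= rank M X)%N.
Proof.
move=> BM; apply: card_le_rank (subsetIr _ _).
by apply: indepS (bases_indep BM); apply: subsetIl.
Qed.

Lemma base_rank X : exists2 B, B \in bases M & #|B :&: X| = rank M X.
Proof.
have [I [iI sI cI]] := rank_basis X.
have [B [iB sIB _ cB]] := indep_extend_rank iI (subsetT I).
have BM : B \in bases M by rewrite basesE iB cB eqxx.
exists B => //; apply/eqP; rewrite eqn_leq card_baseI //= -cI.
by rewrite subset_leq_card // subsetI sIB.
Qed.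

Lemma restr_coloopE X e :
  restr_coloop M X e = (e \in X) && (rank M (X :\ e) < rank M X)%N.
Proof.
rewrite /restr_coloop; case eX: (e \in X) => //=.
apply/forall_inP/idP => [all|lt I].
  rewrite ltnNge; apply/negP => le.
  have [I [iI sI cI]] := rank_basis (X :\ e).
  have sIX : I \subset X by apply: subset_trans sI (subsetDl _ _).
  have : I \in restr_bases M X.
    rewrite inE; apply/maxsetP; rewrite iI sIX; split=> // J /andP[iJ sJ] sIJ.
    apply/eqP; rewrite eq_sym eqEcard sIJ cI (leq_trans _ le) //.
    exact: card_le_rank.
  by move=> /all /(subsetP sI); rewrite !inE eqxx.
rewrite inE => /maxsetP[/andP[iI sI] max]; apply/negPn/negP => eI.
have [J [iJ sIJ sJ cJ]] := indep_extend_rank iI sI.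
move: lt; rewrite ltnNge -cJ (max J) ?iJ // => /negP; apply.
by apply: card_le_rank iI _; rewrite subsetD1 sI.
Qed.

Lemma cyclic_flatP X :
  reflect ((forall e, e \notin X -> (rank M X < rank M (e |: X))%N) /\
           (forall e, e \in X -> rank M (X :\ e) = rank M X))
          (X \in cyclic_flats M).
Proof.
rewrite inE; apply: (iffP andP) => [[/forallP fl /forallP cyc]|[fl cyc]]; split.
- by move=> e eX; have := fl e; rewrite eX.
- move=> e eX; have := cyc e; rewrite restr_coloopE eX /= -leqNgt => le.
  by apply/eqP; rewrite eqn_leq le rankS // subsetDl.
- by apply/forallP => e; apply/implyP; apply: fl.
- apply/forallP => e; rewrite restr_coloopE; apply/negP => /andP[eX].
  by rewrite cyc // ltnn.
Qed.

Lemma flat_eq X Y : X \in cyclic_flats M -> X \subset Y ->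
  (rank M Y <= rank M X)%N -> X = Y.
Proof.
move=> /cyclic_flatP[fl _] sXY le; apply/eqP; rewrite eqEsubset sXY /=.
apply/subsetP => e eY; apply/negPn/negP => /fl; rewrite ltnNge => /negP; apply.
by apply: leq_trans le; apply: rankS; rewrite subUset sub1set eY.
Qed.

(** Deleting the coloops of the restriction to a flat, one by one, leads to its
    largest cyclic flat. *)
Lemma flat_cyclic_part X : flat M X -> exists F,
  [/\ F \in cyclic_flats M, F \subset X,
      (rank M F + #|X :\: F| <= rank M X)%N
    & forall Y, Y \in cyclic_flats M -> Y \subset X -> Y \subset F].
Proof.
have [n] := ubnP #|X|; elim: n X => // n IHn X ltX flX.
case cycX: [forall e, ~~ restr_coloop M X e].
  by exists X; rewrite inE flX cycX setDv cards0 addn0.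
move/negbT: cycX; rewrite negb_forall => /existsP[e]; rewrite negbK restr_coloopE.
move=> /andP[eX lt].
have cX := cardsD1 e X; rewrite eX add1n in cX.
have [||F [Fc sF rF maxF]] := IHn (X :\ e); first by rewrite -ltnS -cX.
  apply/forallP => f; apply/implyP => fX; rewrite ltnNge; apply/negP => le.
  have eqf : rank M (f |: X :\ e) = rank M (X :\ e).
    by apply/eqP; rewrite eqn_leq le rankS // subsetUr.
  have eqX := rankU1_submod (subsetDl X [set e]) eqf.
  have [fe|fe] := eqVneq f e.
    by move: le; rewrite fe setD1K // leqNgt lt.
  move/forallP/(_ f)/implyP: flX; rewrite eqX ltnn.
  by case: (boolP (f \in X)) fX => [fX|_ _ /(_ isT)//]; rewrite !inE fe fX.
have sXe := subsetDl X [set e].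
have sFX := subset_trans sF sXe.
exists F; split => //.
  have -> : X :\: F = e |: ((X :\ e) :\: F).
    apply/setP => t; rewrite !inE; case: (eqVneq t e) => [->|] //=.
    by rewrite eX andbT; apply/negP => /(subsetP sF); rewrite !inE eqxx.
  by rewrite cardsU1 !inE eqxx andbF /=; move: rF lt; clear; lia.
move=> Y Yc sYX; apply: maxF => //; rewrite subsetD1 sYX; apply/negP => eY.
have /cyclic_flatP[_ /(_ e eY) cycY] := Yc.
have : rank M (e |: (X :\ e)) = rank M (X :\ e).
  by apply: (@rankU1_submod e (Y :\ e)); rewrite ?setSD // setD1K.
by rewrite setD1K // => eqX; rewrite eqX ltnn in lt.
Qed.

(** The rank function is determined by the cyclic flats and their ranks: the
    bound [rank M A <= rank M F + #|A :\: F|] holds for every set [F], and the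
    largest cyclic flat inside the closure of [A] attains it. *)
Lemma rank_cyclic A : exists2 F, F \in cyclic_flats M &
  (rank M F + #|A :\: F| <= rank M A)%N.
Proof.
have [n] := ubnP #|~: A|; elim: n A => // n IHn A ltA.
case flA: (flat M A).
  by have [F [Fc _ ? _]] := flat_cyclic_part flA; exists F.
move/negbT: flA; rewrite negb_forall => /existsP[e].
rewrite negb_imply -leqNgt => /andP[eA le].
have [|F Fc rF] := IHn (e |: A).
  move: ltA; rewrite (cardsD1 e) inE eA ltnS; apply: leq_trans; rewrite ltnS.
  by apply/subset_leq_card/subsetP => t; rewrite !inE negb_or.
exists F => //; apply: leq_trans le; apply: leq_trans rF.
by rewrite leq_add2l subset_leq_card // setSD // subsetUr.
Qed.

Lemma rank_le_setD A F : (rank M A <= rank M F + #|A :\: F|)%N.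
Proof.
apply: leq_trans (rank_setD A F) _; rewrite leq_add2r rankS //; exact: subsetIr.
Qed.

Lemma indep_cyclic I :
  reflect (forall F, F \in cyclic_flats M -> (#|I :&: F| <= rank M F)%N) (indep M I).
Proof.
apply: (iffP idP) => [iI F _|le].
  by apply: card_le_rank (subsetIr _ _); apply: indepS iI; apply: subsetIl.
rewrite indep_rank; have [F Fc] := rank_cyclic I; apply: leq_trans.
by rewrite -(cardsID F I) leq_add2r le.
Qed.

End Rank.

(** * Isomorphisms preserve ranks and cyclic flats *)

Section Isomorphism.
Variables (T U : finType) (M : matroid T) (N : matroid U) (f : T -> U).
Hypothesis f_bij : bijective f.
Hypothesis fB : forall B : {set T}, ((f @: B)%SET \in bases N) = (B \in bases M).

Lemma imset_bij_inv (B : {set U}) : exists B' : {set T}, B = f @: B'.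
Proof.
have [g fK gK] := f_bij; exists (g @: B).
by rewrite -imset_comp (eq_imset _ gK) imset_id.
Qed.

Let f_inj := bij_inj f_bij.

Lemma imset_bijS (A B : {set T}) : (f @: A \subset f @: B) = (A \subset B).
Proof.
apply/subsetP/subsetP => sAB t.
  by move=> tA; have := sAB _ (imset_f f tA); rewrite mem_imset.
by case/imsetP => s /sAB sB ->; rewrite imset_f.
Qed.

Lemma indep_iso (I : {set T}) : indep N (f @: I) = indep M I.
Proof.
apply/existsP/existsP => -[B /andP[BM sI]].
  have [B' eB] := imset_bij_inv B; exists B'.
  by move: BM sI; rewrite eB fB imset_bijS => -> ->.
by exists (f @: B); rewrite fB BM imset_bijS.
Qed.

Lemma rank_iso (X : {set T}) : rank N (f @: X) = rank M X.
Proof.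
apply/eqP; rewrite eqn_leq; apply/andP; split; apply/rank_leP => I.
  have [J ->] := imset_bij_inv I; rewrite indep_iso imset_bijS card_imset //.
  exact: card_le_rank.
move=> iI sI; rewrite -(card_imset _ f_inj); apply: card_le_rank.
  by rewrite indep_iso.
by rewrite imset_bijS.
Qed.

Lemma cyclic_flats_iso (X : {set T}) : (f @: X \in cyclic_flats N) = (X \in cyclic_flats M).
Proof.
have [g fK gK] := f_bij.
have fU1 e : f e |: f @: X = f @: (e |: X) by rewrite imsetU1.
have fD1 e : (f @: X) :\ f e = f @: (X :\ e).
  apply/setP => u; rewrite -(gK u) !(inE, mem_imset) //.
  by rewrite (inj_eq f_inj).
apply/cyclic_flatP/cyclic_flatP => -[fl cyc]; split=> [e eX|e eX].
- by rewrite -!rank_iso -fU1 fl // mem_imset.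
- by rewrite -!rank_iso -fD1 cyc // mem_imset.
- by rewrite -(gK e) fU1 !rank_iso fl // -(mem_imset _ _ f_inj) gK.
- by rewrite -(gK e) fD1 !rank_iso cyc // -(mem_imset _ _ f_inj) gK.
Qed.

End Isomorphism.

(** * The inequalities of the base polytope *)

Section BasePolytope.
Variables (R : realType) (T : finType) (M : matroid T).
Implicit Types (x y z : {ffun T -> R}) (A C F : {set T}) (a b e : T).

Definition mass x A : R := \sum_(e in A) x e.

Lemma massUI x A C : mass x (A :|: C) + mass x (A :&: C) = mass x A + mass x C.
Proof.
rewrite /mass !(big_mkcond (fun e => e \in _)) -!big_split; apply: eq_bigr => e _ /=.
by rewrite !inE; case: (e \in A); case: (e \in C); rewrite ?addr0 ?add0r.
Qed.

Lemma mass_indicator B A : mass (indicator_vector R B) A = #|B :&: A|%:R.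
Proof.
rewrite /mass (eq_bigr (fun e => (e \in B)%:R)) => [|e _]; last by rewrite ffunE.
rewrite -natr_sum; congr _%:R.
rewrite -sum1_card big_mkcond [RHS]big_mkcond; apply: eq_bigr => e _ /=.
by rewrite inE; case: (e \in A); case: (e \in B).
Qed.

Lemma base_polytope_vertex B : B \in bases M -> base_polytope M (indicator_vector R B).
Proof.
move=> BM; exists (fun C => (C == B)%:R); split=> [C _||e].
- exact: ler0n.
- rewrite (bigD1 B) //= eqxx big1 ?addr0 // => C /andP[_ /negPf->] //.
- rewrite (bigD1 B) //= eqxx mul1r big1 ?addr0 // => C /andP[_ /negPf->].
  by rewrite mul0r.
Qed.

Lemma base_polytope_convex x y z (s t : R) : 0 <= s -> 0 <= t -> s + t = 1 ->
  (forall e, x e = s * y e + t * z e) ->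
  base_polytope M y -> base_polytope M z -> base_polytope M x.
Proof.
move=> s0 t0 st ex [u [u0 u1 uE]] [v [v0 v1 vE]].
exists (fun C => s * u C + t * v C); split=> [B BM||e].
- by rewrite addr_ge0 // mulr_ge0 ?u0 ?v0.
- by rewrite big_split /= -!mulr_sumr u1 v1 !mulr1.
- rewrite ex uE vE !mulr_sumr -big_split /=; apply: eq_bigr => B _.
  by rewrite mulrDl !mulrA.
Qed.

(** The face [x(T) = rank T] of the independence polytope. *)
Definition rank_inequalities x :=
  [/\ forall e, 0 <= x e, forall A, mass x A <= (rank M A)%:R
    & mass x setT = (rank M setT)%:R].

Lemma base_polytope_mass x : base_polytope M x -> rank_inequalities x.
Proof.
case=> w [w0 w1 wE].
have xA A : mass x A = \sum_(B in bases M) w B * #|B :&: A|%:R.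
  rewrite /mass (eq_bigr _ (fun e _ => wE e)) exchange_big /=.
  by apply: eq_bigr => B _; rewrite -mulr_sumr -mass_indicator.
split=> [e|A|].
- rewrite wE sumr_ge0 // => B BM; rewrite mulr_ge0 ?w0 // ffunE; exact: ler0n.
- rewrite xA -[leRHS]mul1r -[X in _ <= X * _]w1 mulr_suml ler_sum // => B BM.
  by apply: ler_wpM2l; rewrite ?w0 // ler_nat card_baseI.
- rewrite xA -[RHS]mul1r -[X in _ = X * _]w1 mulr_suml; apply: eq_bigr => B BM.
  by rewrite setIT (card_base BM).
Qed.

Definition tight x A := mass x A == (rank M A)%:R.

Lemma tightI x A C : (forall A, mass x A <= (rank M A)%:R) ->
  tight x A -> tight x C -> tight x (A :&: C).
Proof.
move=> le /eqP tA /eqP tC; rewrite /tight eq_le le /=.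
have := massUI x A C; have := le (A :|: C); have := rank_submod M A C.
by rewrite -(ler_nat R) !natrD tA tC; lra.
Qed.

(** In a smallest tight set containing a fractional coordinate there are two of
    them, because its mass is an integer; intersecting with it shows that no
    tight set separates the two. *)
Lemma fractional_pair x e : rank_inequalities x -> 0 < x e < 1 ->
  exists a b, [/\ a != b, 0 < x a < 1, 0 < x b < 1
    & forall A, tight x A -> (a \in A) = (b \in A)].
Proof.
case=> x0 le xT fe.
pose p A := tight x A && [exists e in A, 0 < x e < 1].
have pT : p setT.
  rewrite /p /tight xT eqxx; apply/existsP; exists e; by rewrite inE.
case: (arg_minnP (fun A : {set T} => #|A|) pT) => A /andP[tA /existsP[a /andP[aA fa]]] minA.
have sub C c : tight x C -> c \in C -> c \in A -> 0 < x c < 1 -> A \subset C.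
  move=> tC cC cA fc; have : p (C :&: A).
    by rewrite /p tightI //; apply/existsP; exists c; rewrite inE cC cA.
  move=> /minA leA; have /eqP <- : C :&: A == A by rewrite eqEcard subsetIr.
  exact: subsetIl.
have x1 c : x c <= 1.
  have := le [set c]; rewrite /mass big_set1 => /le_trans; apply.
  by rewrite lern1 (leq_trans (rank_card M _)) ?cards1.
case: (pickP (fun b => [&& b \in A, b != a & 0 < x b < 1])) => [b /and3P[bA ba fb]|none].
  exists a, b; rewrite eq_sym ba; split=> // C tC; apply/idP/idP => h.
    exact: subsetP (sub C a tC h aA fa) _ bA.
  exact: subsetP (sub C b tC h bA fb) _ aA.
exfalso; have : mass x (A :\ a) = #|[set c in A :\ a | x c == 1]|%:R.
  rewrite /mass -sum1_card natr_sum big_mkcond [RHS]big_mkcond; apply: eq_bigr => c _.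
  have := none c; rewrite !inE; case: (c == a) => //=; case: (c \in A) => //=.
  move=> /negbT; rewrite negb_and -!leNgt.
  case/orP=> xc; last by have /eqP-> : x c == 1 by [rewrite eq_le x1]; rewrite eqxx.
  have /eqP-> : x c == 0 by rewrite eq_le xc x0.
  by rewrite eq_sym oner_eq0.
set m := #|_| => mE; move: (tA); rewrite /tight {1}/mass (big_setD1 a) //= -/(mass x _) mE.
move=> /eqP eq; move: fa => /andP[a0 a1].
have : (m < rank M A)%N by rewrite -(ltr_nat R); lra.
have : (rank M A < m.+1)%N by rewrite -(ltr_nat R) -[m.+1]addn1 natrD; lra.
by lia.
Qed.

Definition transfer x (t : R) a b : {ffun T -> R} :=
  [ffun e => x e + t * ((e == a)%:R - (e == b)%:R)].

Lemma mass_transfer x t a b A :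
  mass (transfer x t a b) A = mass x A + t * ((a \in A)%:R - (b \in A)%:R).
Proof.
rewrite /mass (eq_bigr _ (fun e _ => ffunE _ e)) big_split /= -mulr_sumr sumrB.
have delta c : \sum_(e in A) (e == c)%:R = (c \in A)%:R :> R.
  case cA: (c \in A).
    by rewrite (big_setD1 c) //= eqxx big1 ?addr0 // => e; rewrite !inE => /andP[/negPf->].
  by rewrite big1 // => e eA; case: eqP => // ec; rewrite -ec eA in cA.
by rewrite !delta.
Qed.

Let measure x := (#|[set A | ~~ tight x A]| + #|[set e | (0 < x e)%R]|)%N.

(** Mass is moved from [b] to [a] until a new set becomes tight or [b] becomes
    empty. *)
Lemma transfer_step x a b : rank_inequalities x -> a != b ->
    0 < x a < 1 -> 0 < x b < 1 -> (forall A, tight x A -> (a \in A) = (b \in A)) ->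
  exists2 t, 0 < t & rank_inequalities (transfer x t a b) /\
    (measure (transfer x t a b) < measure x)%N.
Proof.
move=> [x0 le xT] ab /andP[xa0 xa1] /andP[xb0 xb1] sep.
pose slack A := (rank M A)%:R - mass x A.
pose p A := (a \in A) && (b \notin A).
have pa : p [set a] by rewrite /p !inE eqxx eq_sym.
case: (arg_minP slack pa) => A /andP[aA bA] minA.
have slack0 C : p C -> 0 < slack C.
  move=> /andP[aC bC]; rewrite subr_gt0 lt_neqAle le andbT.
  by apply/negP => /sep; rewrite aC (negPf bC).
have sA := slack0 A; rewrite /p aA bA in sA.
have keep t C : tight x C -> tight (transfer x t a b) C.
  move=> tC; rewrite /tight mass_transfer (sep _ tC) subrr mulr0 addr0 //.
have face t : 0 < t -> t <= slack A -> t <= x b ->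
    rank_inequalities (transfer x t a b).
  move=> t0 ts tb; split=> [e|C|]; last first.
  - by rewrite mass_transfer !inE subrr mulr0 addr0.
  - rewrite mass_transfer; have := le C; have := minA C; rewrite /p /slack in ts *.
    by case: (a \in C); case: (b \in C) => /=; first [move=> _; lra | move=> /(_ isT); lra].
  - rewrite ffunE; have := x0 e; case: (eqVneq e a) => [->|ea].
      by rewrite (negPf ab) /=; lra.
    by case: (eqVneq e b) => [->|eb] /=; lra.
have supp t e : 0 < t -> 0 < transfer x t a b e -> 0 < x e.
  move=> t0; rewrite ffunE; case: (eqVneq e a) => [->//|ea].
  by case: (eqVneq e b) => [->|eb] /=; lra.
have subt t : [set C | ~~ tight (transfer x t a b) C] \subset [set C | ~~ tight x C].
  by apply/subsetP => C; rewrite !inE; apply/contra/keep.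
have subs t : 0 < t -> [set e | 0 < transfer x t a b e] \subset [set e | 0 < x e].
  by move=> t0; apply/subsetP => e; rewrite !inE; apply: supp.
case: (lerP (slack A) (x b)) => [sb|bs].
  exists (slack A); first exact: sA.
  split; first by apply: face; rewrite ?sA.
  rewrite /measure -addSn leq_add ?subset_leq_card ?subs ?sA //.
  apply/proper_card/properP; split=> //; exists A; rewrite !inE.
    by apply/negP => /sep; rewrite aA (negPf bA).
  rewrite negbK /tight mass_transfer aA (negPf bA) /slack /=; apply/eqP; ring.
exists (x b) => //; split; first by apply: face => //; apply: ltW.
rewrite /measure -addnS leq_add ?subset_leq_card //.
apply/proper_card/properP; split; first exact: subs.
exists b; rewrite !inE //= ffunE eqxx eq_sym (negPf ab) /=; lra.
Qed.

(** Edmonds' theorem.  A point with a fractional coordinate lies between the results of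
    two opposite transfers of mass, both of which have more tight sets or a smaller
    support; a point without is the indicator vector of a base. *)
Lemma base_polytope_rank x : rank_inequalities x -> base_polytope M x.
Proof.
have [n] := ubnP (measure x); elim: n x => // n IHn x ltn Qx.
have [x0 le xT] := Qx.
case: (pickP (fun e => 0 < x e < 1)) => [e fe|none].
  have [a [b [ab fa fb sep]]] := fractional_pair Qx fe.
  have [t t0 [Qy ly]] := transfer_step Qx ab fa fb sep.
  have ba : b != a by rewrite eq_sym.
  have sep' A : tight x A -> (b \in A) = (a \in A) by move=> /sep.
  have [s s0 [Qz lz]] := transfer_step Qx ba fb fa sep'.
  have st : s + t != 0 by rewrite gt_eqF // addr_gt0.
  apply: (@base_polytope_convex x (transfer x t a b) (transfer x s b a)
    (s / (s + t)) (t / (s + t))).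
  - by rewrite divr_ge0 // ltW // addr_gt0.
  - by rewrite divr_ge0 // ltW // addr_gt0.
  - by rewrite -mulrDl divff.
  - move=> c; rewrite !ffunE; move: (c == a)%:R (c == b)%:R (x c) => u v w.
    by field.
  - by apply: IHn Qy; apply: leq_trans ly _; rewrite -ltnS.
  - by apply: IHn Qz; apply: leq_trans lz _; rewrite -ltnS.
pose I := [set e | x e == 1].
have xI : x = indicator_vector R I.
  apply/ffunP => e; rewrite ffunE inE; case: eqP => [->//|xe1].
  move/negbT: (none e); rewrite negb_and -!leNgt => /orP[xe|xe].
    by apply/eqP; rewrite eq_le xe x0.
  case: xe1; apply/eqP; rewrite eq_le xe andbT.
  have := le [set e]; rewrite /mass big_set1 => /le_trans; apply.
  by rewrite lern1 (leq_trans (rank_card M _)) ?cards1.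
rewrite xI; apply: base_polytope_vertex; rewrite basesE indep_rank.
have := le I; rewrite xI mass_indicator setIid ler_nat => -> /=.
by move: xT; rewrite xI mass_indicator setIT => /eqP; rewrite eqr_nat.
Qed.

(** As no coordinate exceeds 1, the points of [A :\: F] contribute at most
    [#|A :\: F|] to the mass, which [rank_cyclic] bounds. *)
Lemma slack_cyclic x A : (forall e, 0 <= x e <= 1) ->
  exists2 F, F \in cyclic_flats M & (rank M F)%:R - mass x F <= (rank M A)%:R - mass x A.
Proof.
move=> x01; have [F Fc leF] := rank_cyclic M A; exists F => //.
have -> : mass x A = mass x (A :&: F) + mass x (A :\: F) by rewrite /mass (big_setID F).
have leI : mass x (A :&: F) <= mass x F.
  rewrite /mass [leRHS](big_setID A) /= setIC lerDl.
  by apply: sumr_ge0 => e _; case/andP: (x01 e).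
have leD : mass x (A :\: F) <= #|A :\: F|%:R.
  by rewrite -sum1_card natr_sum; apply: ler_sum => e _; case/andP: (x01 e).
by move: leF; rewrite -(ler_nat R) natrD; lra.
Qed.

Lemma base_polytopeP x : base_polytope M x <->
  [/\ forall e, 0 <= x e <= 1, mass x setT = (rank M setT)%:R
    & forall F, F \in cyclic_flats M -> mass x F <= (rank M F)%:R].
Proof.
split=> [/base_polytope_mass[x0 le xT]|[x01 xT le]].
  split=> // e; rewrite x0 /=.
  have := le [set e]; rewrite /mass big_set1 => /le_trans; apply.
  by rewrite lern1 (leq_trans (rank_card M _)) ?cards1.
apply: base_polytope_rank; split=> // [e|A]; first by case/andP: (x01 e).
have [F /le leF] := slack_cyclic A x01; lra.
Qed.

End BasePolytope.

(** * The Schubert matroid of a chain of cyclic flats *)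

Section ChainMatroid.
Variables (T : finType) (M : matroid T) (C : {set {set T}}).
Hypothesis C_chain : forall X Y, X \in C -> Y \in C -> (X \subset Y) || (Y \subset X).
Hypothesis C0 : set0 \in C.
Implicit Types (X Y F B : {set T}).

Definition chain_bases : {set {set T}} :=
  [set B : {set T} | (#|B| == rank M setT) && [forall F in C, (#|B :&: F| <= rank M F)%N]].

Lemma chain_basesP B :
  reflect (#|B| = rank M setT /\ forall F, F \in C -> (#|B :&: F| <= rank M F)%N)
          (B \in chain_bases).
Proof.
rewrite inE; apply: (iffP andP) => [[/eqP cB /forall_inP le]|[cB le]]; split=> //.
  exact/eqP.
exact/forall_inP.
Qed.

Lemma base_chain_base B : B \in bases M -> B \in chain_bases.
Proof.
by move=> BM; apply/chain_basesP; split; [exact: card_base|move=> F _; exact: card_baseI].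
Qed.

Definition chain_tight B F := (F \in C) && (#|B :&: F| == rank M F).

Lemma chain_tight_max B (p : pred {set T}) F0 : chain_tight B F0 -> p F0 ->
  exists F, [/\ chain_tight B F, p F
    & forall G, chain_tight B G -> p G -> G \subset F].
Proof.
move=> t0 p0; have pq : [pred F | chain_tight B F && p F] F0 by rewrite /= t0.
case: (arg_maxnP (fun F : {set T} => #|F|) pq) => F /andP[tF pF] maxF.
exists F; split=> // G tG pG.
have /orP[//|sFG] := C_chain (andP tG).1 (andP tF).1.
have /eqP-> // : F == G.
rewrite eqEcard sFG; apply: maxF; by rewrite /= tG pG.
Qed.

(** Exchanging [x] for [y] can only increase [#|B :&: F|] on sets containing [y]
    but not [x]. *)
Lemma chain_exchange B x y : B \in chain_bases -> x \in B -> y \notin B ->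
  (forall F, chain_tight B F -> y \in F -> x \in F) -> y |: (B :\ x) \in chain_bases.
Proof.
move=> /chain_basesP[cB leB] xB yB tB; apply/chain_basesP; split.
  by rewrite -cB cardsU1 !inE (negPf yB) andbF (cardsD1 x B) xB.
move=> F FC; have := leB F FC; rewrite setIUl setIDAC.
case yF: (y \in F); last first.
  have -> : [set y] :&: F = set0.
    by apply/setP => t; rewrite !inE; case: eqP => // ->; rewrite yF.
  by rewrite set0U; apply: leq_trans; rewrite subset_leq_card // subsetDl.
have -> : [set y] :&: F = [set y] by apply/setIidPl; rewrite sub1set.
rewrite cardsU1 !inE (negPf yB) /= andbF /=.
rewrite (cardsD1 x (B :&: F)) inE xB /= => leF.
have [xF|xF] := boolP (x \in F); first by move: leF; rewrite xF.
rewrite (negPf xF) add0n leq_eqVlt in leF; case/orP: leF => [tF|]; last by rewrite add1n.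
have := tB F; rewrite /chain_tight FC (cardsD1 x (B :&: F)) inE xB (negPf xF) add0n tF.
by move=> /(_ isT yF).
Qed.

Lemma chain_tight0 B : chain_tight B set0.
Proof. by rewrite /chain_tight C0 setI0 cards0 rank0. Qed.

(** The new element must avoid the tight sets that do not contain [x].  They have a
    largest member [F], because [C] is a chain, and [B2] has at least as many elements
    outside [F] as [B1]. *)
Lemma chain_bases_exchange B1 B2 : B1 \in chain_bases -> B2 \in chain_bases ->
  forall x, x \in B1 :\: B2 ->
  exists2 y, y \in B2 :\: B1 & y |: (B1 :\ x) \in chain_bases.
Proof.
move=> B1M B2M x; rewrite inE => /andP[xB2 xB1].
have [|F [tF xF maxF]] := @chain_tight_max B1 (fun F => x \notin F) set0 (chain_tight0 _).
  by rewrite inE.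
have : (#|(B1 :\: F) :\ x| < #|B2 :\: F|)%N.
  have [c1 _] := chain_basesP _ B1M; have [c2 leB2] := chain_basesP _ B2M.
  have /andP[FC /eqP eF] := tF; have := leB2 F FC.
  have := cardsID F B1; have := cardsID F B2; rewrite (cardsD1 x (B1 :\: F)) inE xF xB1.
  rewrite c1 c2 eF; lia.
rewrite ltnNge => /negP lt.
have [/eqP|[y yD]] := set_0Vmem ((B2 :\: F) :\: ((B1 :\: F) :\ x)).
  by rewrite setD_eq0 => /subset_leq_card.
have [yF yB1 yB2] : [/\ y \notin F, y \notin B1 & y \in B2].
  move: yD; rewrite !inE; case: (y \in F); rewrite ?andbF //=.
  case: (y \in B1); rewrite /= ?andbF //= ?andbT negbK => /andP[/eqP-> ].
  by rewrite (negPf xB2).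
exists y; first by rewrite inE yB1.
apply: chain_exchange => // G tG yG; apply/negPn/negP => xG.
by have := subsetP (maxF G tG xG) _ yG; rewrite (negPf yF).
Qed.

Lemma chain_bases_neq0 : chain_bases != set0.
Proof.
have /set0Pn[B BM] := bases_neq0 M; apply/set0Pn; exists B; exact: base_chain_base.
Qed.

Definition chain_matroid : matroid T := Matroid chain_bases_neq0 chain_bases_exchange.

Let N := chain_matroid.

Lemma rank_chain_matroid_ge X : (rank M X <= rank N X)%N.
Proof.
have [B BM <-] := base_rank M X; exact: (@card_baseI _ N _ _ (base_chain_base BM)).
Qed.

Lemma rank_chain_matroid F : F \in C -> rank N F = rank M F.
Proof.
move=> FC; apply/eqP; rewrite eqn_leq rank_chain_matroid_ge andbT.
have [B BN <-] := base_rank N F; have [_] := chain_basesP _ BN; exact.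
Qed.

Hypothesis CT : setT \in C.
Hypothesis C_cyclic : {subset C <= cyclic_flats M}.

Lemma chain_cyclic_flat F : F \in C -> F \in cyclic_flats N.
Proof.
move=> FC; have /cyclic_flatP[fl cyc] := C_cyclic FC; apply/cyclic_flatP; split=> e eF.
  by rewrite rank_chain_matroid // (leq_trans (fl e eF)) // rank_chain_matroid_ge.
apply/eqP; rewrite eqn_leq rankS ?subsetDl //= rank_chain_matroid // -(cyc e eF).
exact: rank_chain_matroid_ge.
Qed.

(** As [x] is no coloop of the restriction to [X], some basis of [X] avoids it, and an
    element of that basis can replace [x]. *)
Lemma base_swap X B x : X \in cyclic_flats N -> B \in bases N ->
    #|B :&: X| = rank N X -> x \in B :&: X ->
  exists2 y, y \in X :\: B & y |: (B :\ x) \in bases N.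
Proof.
move=> /cyclic_flatP[_ cyc] BN cB; rewrite inE => /andP[xB xX].
have iB : indep N ((B :&: X) :\ x).
  apply: indepS (bases_indep BN); apply: subset_trans (subsetDl _ _) (subsetIl _ _).
have [J [iJ sJ cJ]] := rank_basis N (X :\ x).
have [|y] := indep_augment iB iJ.
  by rewrite cJ (cyc x xX) -cB [X in (_ < X)%N](cardsD1 x) inE xB xX.
rewrite !inE => /andP[yB yJ] iy.
have := subsetP sJ y yJ; rewrite !inE => /andP[yx yX].
have {}yB : y \notin B by move: yB; rewrite yx yX andbT.
exists y; first by rewrite inE yB.
have [B' B'N /andP[s1 s2]] := indep_extend iy BN.
suff -> : y |: (B :\ x) = B' by [].
have cBB' := bases_card BN B'N.
apply/esym/eqP; rewrite eqEcard cardsU1 !inE (negPf yB) andbF -cBB' [#|B|](cardsD1 x) xB.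
rewrite leqnn andbT.
apply/subsetP => z zB'; rewrite !inE; have := subsetP s2 z zB'; rewrite !inE.
case: (eqVneq z y) => //= zy; case: (eqVneq z x) => [zx|zx] /=; last first.
  by case: (z \in B); rewrite ?andbF.
move=> _; exfalso.
have : (#|y |: (B :&: X)| <= rank N X)%N.
  rewrite -cB; apply: leq_trans (_ : #|B' :&: X| <= _)%N.
    apply/subset_leq_card/subsetP => t; rewrite !inE.
    case: (eqVneq t y) => [->|ty] /=; first by rewrite yX (subsetP s1) // !inE eqxx.
    move=> /andP[tB tX]; rewrite tX andbT; case: (eqVneq t x) => [->|tx]; first by rewrite -zx.
    by rewrite (subsetP s1) // !inE tB tX tx orbT.
  rewrite cB; exact: card_baseI.
by rewrite cardsU1 inE (negPf yB) cB /= add1n ltnn.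
Qed.

(** For a base [B] spanning the cyclic flat [X], the fundamental circuit of [y]
    consists of [y] and of the part of [B] in the least tight set of [C] containing
    [y].  The largest of these tight sets, for [y] in [X :\: B], is [X]. *)
Lemma cyclic_flat_chain X : X \in cyclic_flats N -> X \in C.
Proof.
move=> Xc; have [B BN cB] := base_rank N X.
have BC : B \in chain_bases := BN.
have [cBT leB] := chain_basesP _ BC.
have tT : chain_tight B setT by rewrite /chain_tight CT setIT cBT eqxx.
have pT : [pred F | chain_tight B F && (X :\: B \subset F)] setT.
  by rewrite /= tT subsetT.
case: (arg_minnP (fun F : {set T} => #|F|) pT) => F /andP[tF sF] minF.
have FC := (andP tF).1.
have sXF : X \subset F.
  apply/subsetP => x xX; case xB: (x \in B); last by rewrite (subsetP sF) // inE xB.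
  have [|y yD yN] := base_swap Xc BN cB (x := x); first by rewrite inE xB.
  have yF := subsetP sF y yD; move: yD; rewrite inE => /andP[yB yX].
  have [_ /(_ F FC)] := chain_basesP _ yN.
  apply: contraTT => xF; rewrite -ltnNge.
  have /andP[_ /eqP <-] := tF.
  rewrite setIUl setIDAC.
  have -> : [set y] :&: F = [set y] by apply/setIidPl; rewrite sub1set.
  have -> : (B :&: F) :\ x = B :&: F.
    by apply/setDidPl; rewrite disjoint_sym disjoints1 inE (negPf xF) andbF.
  by rewrite cardsU1 inE (negPf yB).
have sBF : B :&: F \subset X.
  apply/subsetP => z; rewrite inE => /andP[zB zF]; apply/negPn/negP => zX.
  have [|G [tG zG maxG]] := @chain_tight_max B (fun F => z \notin F) set0 (chain_tight0 _).
    by rewrite inE.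
  have : ~~ (X :\: B \subset G).
    apply/negP => sG; have /minF leF : [pred F | chain_tight B F && (X :\: B \subset F)] G.
      by rewrite /= tG.
    have /orP[sGF|sFG] := C_chain (andP tG).1 FC; last first.
      by move: zG; rewrite (subsetP sFG).
    have /eqP eG : G == F by rewrite eqEcard sGF.
    by rewrite eG zF in zG.
  case/subsetPn => y; rewrite inE => /andP[yB yX] yG.
  have : y |: (B :\ z) \in chain_bases.
    apply: chain_exchange => // H tH yH; apply/negPn/negP => zH.
    by move: yG; rewrite (subsetP (maxG H tH zH)).
  move=> yN; have := @card_baseI _ N _ X yN.
  rewrite -cB setIUl setIDAC.
  have -> : [set y] :&: X = [set y] by apply/setIidPl; rewrite sub1set.
  have -> : (B :&: X) :\ z = B :&: X.
    by apply/setDidPl; rewrite disjoint_sym disjoints1 inE (negPf zX) andbF.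
  by rewrite cardsU1 inE (negPf yB) ltnn.
suff -> : X = F by [].
apply: flat_eq Xc sXF _; rewrite rank_chain_matroid //.
have /andP[_ /eqP <-] := tF; rewrite -cB subset_leq_card // subsetI sBF subsetIl //.
Qed.

Lemma cyclic_flats_chain : cyclic_flats N = C.
Proof.
by apply/setP => X; apply/idP/idP; [exact: cyclic_flat_chain|exact: chain_cyclic_flat].
Qed.

End ChainMatroid.

(** * Orders adapted to a Schubert matroid *)

Section Isomorphic.

Lemma isomorphic_sym (T U : finType) (M : matroid T) (N : matroid U) :
  isomorphic M N -> isomorphic N M.
Proof.
move=> [f [[g fK gK] fB]]; exists g; split; first by exists f.
by move=> B; rewrite -fB -imset_comp (eq_imset _ gK) imset_id.
Qed.

Lemma isomorphic_trans (T U V : finType) (L : matroid T) (M : matroid U) (N : matroid V) :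
  isomorphic L M -> isomorphic M N -> isomorphic L N.
Proof.
move=> [f [bf fB]] [g [bg gB]]; exists (g \o f); split; first exact: bij_comp.
by move=> B; rewrite imset_comp gB fB.
Qed.

Lemma isomorphic_refl (T : finType) (M : matroid T) : isomorphic M M.
Proof. by exists id; split; [exists id | move=> B; rewrite imset_id]. Qed.

Lemma isomorphic_card (T U : finType) (M : matroid T) (N : matroid U) :
  isomorphic M N -> #|T| = #|U|.
Proof. by case=> f [bf _]; exact: bij_eq_card bf. Qed.

End Isomorphic.

Section Orders.
Variables (n : nat) (T : finType).
Hypothesis cardT : #|T| = n.
Implicit Types (g : {ffun T -> 'I_n}) (A G B : {set T}) (N : matroid T).

Definition initial g (i : nat) : {set T} := [set t | (g t < i)%N].

Lemma order_bij g : injective g -> bijective g.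
Proof. by move=> gI; apply: inj_card_bij gI _; rewrite card_ord cardT. Qed.

Lemma card_initial g i : injective g -> (i <= n)%N -> #|initial g i| = i.
Proof.
move=> gI lein.
have -> : initial g i = g @^-1: [set j : 'I_n | (j < i)%N] by apply/setP => t; rewrite !inE.
rewrite on_card_preimset; last exact: onW_bij (order_bij gI).
rewrite -sum1_card (eq_bigl (fun j : 'I_n => (j < i)%N)) => [|j]; last by rewrite inE.
rewrite (big_ord_narrow lein).
by rewrite sum1_card card_ord.
Qed.

(** A linear order of the ground set in which every cyclic flat is an initial
    segment. *)
Definition adapted N g := injective g /\ forall G, G \in cyclic_flats N ->
  forall t u, t \in G -> u \notin G -> (g t < g u)%N.

Lemma adapted_initial N g G i : adapted N g -> G \in cyclic_flats N -> (i <= n)%N ->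
  #|initial g i :\: G| = (i - #|G|)%N.
Proof.
move=> [gI ad] Gc lein; have ci := card_initial gI lein.
have [/eqP D0|[t]] := set_0Vmem (initial g i :\: G).
  rewrite (eqP D0) cards0; move: D0; rewrite setD_eq0 => /subset_leq_card.
  by rewrite ci; lia.
rewrite !inE => /andP[tG ti].
suff sG : G \subset initial g i by rewrite cardsDS // ci.
by apply/subsetP => u uG; rewrite inE; apply: ltn_trans ti; apply: ad Gc _ _ uG tG.
Qed.

(** By [rank_cyclic], a cyclic flat [G] computes the rank of [A]; among the sets of the
    same size, an initial segment leaves the fewest elements outside [G]. *)
Lemma adapted_rank N g A : adapted N g -> (rank N (initial g #|A|) <= rank N A)%N.
Proof.
move=> ad; have [G Gc le] := rank_cyclic N A; apply: leq_trans le.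
apply: leq_trans (rank_le_setD N _ G) _; rewrite leq_add2l.
rewrite (adapted_initial ad Gc) -?cardT ?max_card //.
by rewrite leq_subLR -(cardsID G A) leq_add2r subset_leq_card // subsetIr.
Qed.

Lemma cyclic_flat_initial N g G : adapted N g -> G \in cyclic_flats N ->
  initial g #|G| = G.
Proof.
move=> ad Gc; have leG : (#|G| <= n)%N by rewrite -cardT max_card.
have := adapted_initial ad Gc leG; rewrite subnn => /eqP.
rewrite cards_eq0 setD_eq0 => sG; apply/eqP.
by rewrite eqEcard sG (card_initial ad.1 leG) /=.
Qed.

(** The independence test of [indep_cyclic] only involves initial segments. *)
Lemma adapted_bases N g B : adapted N g ->
  (B \in bases N) = (#|B| == rank N (initial g n)) &&
    [forall i : 'I_n.+1, (#|B :&: initial g i| <= rank N (initial g i))%N].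
Proof.
move=> ad; have -> : initial g n = setT by apply/setP => t; rewrite !inE ltn_ord.
apply/idP/andP => [BN|[/eqP cB /forallP le]].
  split; first by rewrite (card_base BN).
  by apply/forallP => i; apply: card_baseI.
rewrite basesE cB eqxx andbT; apply/indep_cyclic => G Gc.
have leG : (#|G| < n.+1)%N by rewrite ltnS -cardT max_card.
by have := le (Ordinal leG); rewrite (cyclic_flat_initial ad Gc).
Qed.

End Orders.

(** Sort the elements by the number of cyclic flats that miss them. *)
Lemma adapted_exists (n : nat) (T : finType) (N : matroid T) :
  #|T| = n -> schubert N -> exists g : {ffun T -> 'I_n}, adapted N g.
Proof.
move=> <- sch.
pose level (t : T) := #|[set G in cyclic_flats N | t \notin G]|.
have lvl G t u : G \in cyclic_flats N -> t \in G -> u \notin G -> (level t < level u)%N.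
  move=> Gc tG uG; apply/proper_card/properP; split.
    apply/subsetP => H; rewrite in_set => /andP[Hc tH]; rewrite in_set Hc /=.
    have /orP[sGH|sHG] := sch G H Gc Hc.
      by rewrite (subsetP sGH) in tH.
    by apply: contra uG; apply: (subsetP sHG).
  by exists G; rewrite in_set ?Gc ?tG.
pose r : rel T := relpre level leq.
have rtot : total r by move=> x y; apply: leq_total.
have rtr : transitive r by move=> y x z; apply: leq_trans.
have rrefl : reflexive r by move=> x; apply: leqnn.
pose s := sort r (enum T).
have ms t : t \in s by rewrite mem_sort mem_enum.
have lts t : (index t s < #|T|)%N by rewrite cardE -(size_sort r) index_mem.
exists [ffun t => Ordinal (lts t)]; split.
  by move=> t u; rewrite !ffunE => /(congr1 val) /= /index_inj; apply.
move=> G Gc t u tG uG; rewrite !ffunE /= ltnNge; apply/negP => le.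
have := @sorted_leq_index _ r rtr rrefl s (sort_sorted rtot _) u t (ms u) (ms t) le.
by rewrite /r /= leqNgt (lvl G t u Gc tG uG).
Qed.

(** By [adapted_bases], the ranks along an adapted order tell which sets of positions
    are bases. *)
Lemma profile_isomorphic (n : nat) (T U : finType) (M : matroid T) (N : matroid U)
    (g : {ffun T -> 'I_n}) (h : {ffun U -> 'I_n}) :
  #|T| = n -> #|U| = n -> adapted M g -> adapted N h ->
  (forall i, (i <= n)%N -> rank M (initial g i) = rank N (initial h i)) -> isomorphic M N.
Proof.
move=> cT cU adg adh eqr.
have [gi gK giK] := order_bij cT adg.1; have [hi hK hiK] := order_bij cU adh.1.
have hf t : h (hi (g t)) = g t by rewrite hiK.
have bf : bijective (hi \o g).
  by exists (gi \o h) => t /=; rewrite ?hiK ?gK ?giK ?hK.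
have fI := bij_inj bf.
exists (hi \o g); split=> // B.
rewrite (adapted_bases cT _ adg) (adapted_bases cU _ adh) card_imset // eqr //.
congr (_ && _); apply: eq_forallb => i; rewrite (eqr i (ltn_ord i)).
have -> : initial h i = (hi \o g) @: initial g i.
  apply/setP => u; rewrite inE -(hK u) -(giK (h u)) hiK.
  by rewrite (mem_imset _ (gi (h u)) fI) inE.
by rewrite -imsetI ?card_imset // => x y _ _; apply: fI.
Qed.

(** The rank of the initial segment of size [i] of an adapted order is the minimum of
    [rank G + (i - #|G|)] over the cyclic flats [G], so the sizes and ranks of the
    cyclic flats determine the ranks along the order. *)
Lemma schubert_isomorphic (T U : finType) (M : matroid T) (N : matroid U) :
  #|T| = #|U| -> schubert M -> schubert N ->
  (forall G, G \in cyclic_flats M -> exists2 H, H \in cyclic_flats N &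
     #|G| = #|H| /\ rank M G = rank N H) ->
  (forall H, H \in cyclic_flats N -> exists2 G, G \in cyclic_flats M &
     #|G| = #|H| /\ rank M G = rank N H) ->
  isomorphic M N.
Proof.
move=> cTU sM sN MN NM.
have [g adg] := adapted_exists cTU sM; have [h adh] := adapted_exists erefl sN.
apply: (profile_isomorphic cTU erefl adg adh) => i lei.
have bound V W (L : matroid V) (K : matroid W) (a : {ffun V -> 'I_#|U|}) (b : {ffun W -> 'I_#|U|}) :
    #|V| = #|U| -> #|W| = #|U| -> adapted L a -> adapted K b ->
    (forall H, H \in cyclic_flats K -> exists2 G, G \in cyclic_flats L &
      #|G| = #|H| /\ rank L G = rank K H) ->
    (rank L (initial a i) <= rank K (initial b i))%N.
  move=> cV cW ada adb KL.
  have [H Hc] := rank_cyclic K (initial b i); apply: leq_trans.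
  have [G Gc [cG <-]] := KL H Hc.
  apply: leq_trans (rank_le_setD L _ G) _; rewrite leq_add2l.
  by rewrite (adapted_initial cV ada Gc) // (adapted_initial cW adb Hc) // cG.
apply/eqP; rewrite eqn_leq (bound _ _ _ _ _ _ cTU erefl adg adh NM) /=.
apply: (bound _ _ _ _ _ _ erefl cTU adh adg) => G /MN[H Hc [cH rH]].
by exists H; rewrite ?cH ?rH.
Qed.

(** * Weighted walks and the Mobius function *)

Section Walks.
Variables (X : finType) (v : X -> int) (u : nat -> X -> X -> int).

Definition walk_weight k (F : {ffun 'I_k.+1 -> X}) : int :=
  v (F ord0) * \prod_(i < k) u i (F (widen_ord (leqnSn k) i)) (F (lift ord0 i)).

Definition walks k (y : X) : int := \sum_(F : {ffun 'I_k.+1 -> X} | F ord_max == y) walk_weight F.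

Lemma walks0 y : walks 0 y = v y.
Proof.
rewrite /walks (big_pred1 [ffun _ => y]) => [|F].
  by rewrite /walk_weight big_ord0 mulr1 ffunE.
apply/eqP/eqP => [<-|->]; last by rewrite ffunE.
by apply/ffunP => i; rewrite ffunE (ord1 i); congr (F _); apply: val_inj.
Qed.

Definition extend k (p : {ffun 'I_k.+1 -> X} * X) : {ffun 'I_k.+2 -> X} :=
  [ffun i => if unlift ord_max i is Some j then p.1 j else p.2].

Lemma extend_last k p : @extend k p ord_max = p.2.
Proof. by rewrite ffunE unlift_none. Qed.

Lemma extend_widen k p (i : 'I_k.+1) : @extend k p (widen_ord (leqnSn k.+1) i) = p.1 i.
Proof.
have -> : widen_ord (leqnSn k.+1) i = lift ord_max i.
  by apply: val_inj; rewrite /= /bump leqNgt ltn_ord.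
by rewrite ffunE liftK.
Qed.

Lemma extend_bij k : bijective (@extend k).
Proof.
pose restrict (F : {ffun 'I_k.+2 -> X}) : {ffun 'I_k.+1 -> X} * X :=
  ([ffun j => F (lift ord_max j)], F ord_max).
exists restrict => [[F y]|F].
  rewrite /restrict extend_last; congr pair; apply/ffunP => j.
  by rewrite !ffunE liftK.
by apply/ffunP => i; rewrite ffunE; case: unliftP => [j|] -> //=; rewrite ffunE.
Qed.

Lemma walk_weight_extend k (p : {ffun 'I_k.+1 -> X} * X) :
  walk_weight (extend p) = walk_weight p.1 * u k (p.1 ord_max) p.2.
Proof.
rewrite /walk_weight big_ord_recr /= mulrA; congr (_ * _ * u k _ _).
- congr (v _); rewrite -(extend_widen p); congr (extend p _); exact: val_inj.
- apply: eq_bigr => i _; congr (u i _ _); first by rewrite extend_widen.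
  rewrite -(extend_widen p); congr (extend p _); exact: val_inj.
- exact: extend_widen.
- by rewrite -(extend_last p); congr (extend p _); apply: val_inj.
Qed.

(** Transfer-matrix recursion, by splitting off the last vertex. *)
Lemma walksS k y : walks k.+1 y = \sum_z walks k z * u k z y.
Proof.
rewrite /walks (reindex _ (onW_bij _ (extend_bij k))) /=.
under eq_bigl do rewrite extend_last.
rewrite -(pair_big_dep xpredT (fun _ z => z == y) (fun F z => walk_weight (extend (F, z)))) /=.
under eq_bigr do rewrite big_pred1_eq walk_weight_extend /=.
rewrite (partition_big (fun F : {ffun 'I_k.+1 -> X} => F ord_max) xpredT) //=.
apply: eq_bigr => z _; rewrite mulr_suml; apply: eq_bigr => F /eqP <- //.
Qed.

End Walks.

Section Mobius.
Variables (T : finType) (Z : {set {set T}}).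
Implicit Types X Y W : {set T}.

(** The recursion for the Mobius function of [Z] ordered by inclusion; [n] is fuel, for
    which any bound above the size of [Y] will do. *)
Fixpoint mobius_rec n X Y : int :=
  if n is n'.+1 then (X == Y)%:R - \sum_(W in Z | W \proper Y) mobius_rec n' X W else 0.

Definition mobius X Y := mobius_rec #|Y|.+1 X Y.

Lemma mobius_rec_fuel n m X Y : (#|Y| < n)%N -> (#|Y| < m)%N ->
  mobius_rec n X Y = mobius_rec m X Y.
Proof.
elim: n m Y => // n IHn [//|m] Y; rewrite !ltnS => ltn ltm /=; congr (_ - _).
apply: eq_bigr => W /andP[_ /proper_card ltWY].
by apply: IHn; apply: leq_trans ltWY _.
Qed.

Lemma mobiusE X Y : mobius X Y = (X == Y)%:R - \sum_(W in Z | W \proper Y) mobius X W.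
Proof.
rewrite {1}/mobius /=; congr (_ - _); apply: eq_bigr => W /andP[_ /proper_card ltWY].
exact: mobius_rec_fuel.
Qed.

Lemma sum_mobius X Y : Y \in Z -> \sum_(W in Z | W \subset Y) mobius X W = (X == Y)%:R.
Proof.
move=> YZ; rewrite (bigD1 Y) /= ?YZ ?subxx // mobiusE.
rewrite (eq_bigl (fun W => (W \in Z) && (W \proper Y))) ?subrK // => W.
by rewrite properEneq -andbA [(W \subset Y) && _]andbC.
Qed.

Lemma mobius_nsub X Y : ~~ (X \subset Y) -> mobius X Y = 0.
Proof.
have [n] := ubnP #|Y|; elim: n Y => // n IHn Y; rewrite ltnS => ltn sXY.
rewrite mobiusE big1 => [|W /andP[_ ltWY]].
  by rewrite subr0; case: eqP sXY => // ->; rewrite subxx.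
apply: IHn; first by apply: leq_trans (proper_card ltWY) ltn.
by apply: contra sXY => /subset_trans; apply; apply: proper_sub.
Qed.

Lemma mobius_refl X : mobius X X = 1.
Proof.
rewrite mobiusE eqxx big1 ?subr0 // => W /andP[_ ltW]; apply: mobius_nsub.
by apply/negP => /(sub_proper_trans)/(_ ltW); rewrite properxx.
Qed.

End Mobius.

(** * Signed chains of cyclic flats at a point of the hypersimplex *)

Lemma flatI (T : finType) (M : matroid T) (X Y : {set T}) :
  flat M X -> flat M Y -> flat M (X :&: Y).
Proof.
move=> /forallP flX /forallP flY; apply/forallP => e; apply/implyP.
rewrite inE negb_and ltn_neqAle eq_sym => eXY.
rewrite rankS ?subsetUr // andbT; apply/negP => /eqP eqr.
case/orP: eXY => [eX|eY].
  by have := flX e; rewrite eX (rankU1_submod (subsetIl X Y) eqr) ltnn.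
by have := flY e; rewrite eY (rankU1_submod (subsetIr X Y) eqr) ltnn.
Qed.

Section PolytopeIdentity.
Variables (R : realType) (T : finType) (M : matroid T).
Implicit Types (X Y F G W A : {set T}).
Notation Z := (cyclic_flats M).
Notation mu := (mobius Z).
Hypotheses (Z0 : set0 \in Z) (ZT : setT \in Z).
Variable x : {ffun T -> R}.
Hypothesis x01 : forall e, 0 <= x e <= 1.

Let slack X : R := (rank M X)%:R - mass x X.
Let S := [set X in Z | mass x X <= (rank M X)%:R].

Let in_S X : (X \in S) = (X \in Z) && (0 <= slack X).
Proof. by rewrite in_set subr_ge0. Qed.

Lemma slack_removed F A : F \subset A -> (rank M F + #|A :\: F| <= rank M A)%N ->
  slack F <= slack A.
Proof.
move=> sFA; rewrite -(ler_nat R) natrD /slack.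
have -> : mass x A = mass x F + mass x (A :\: F).
  by rewrite /mass (big_setID F) /= (setIidPr sFA).
have : mass x (A :\: F) <= #|A :\: F|%:R; last by lra.
by rewrite -sum1_card natr_sum; apply: ler_sum => e _; case/andP: (x01 e).
Qed.

Lemma slack_submod X Y : slack (X :|: Y) + slack (X :&: Y) <= slack X + slack Y.
Proof.
have := massUI x X Y; have := rank_submod M X Y; rewrite -(ler_nat R) !natrD /slack; lra.
Qed.

Variable m : nat.
Hypothesis m_long : forall F : 'I_m.+1 -> {set T}, (forall i, F i \in Z) ->
  ~ forall i : 'I_m, F (widen_ord (leqnSn m) i) \proper F (lift ord0 i).

Let v X : int := (X == set0)%:R.
Let u (i : nat) X Y : int := ((Y \in S) && (X \proper Y))%:R * - mu X Y.
Let g Y := \sum_(k < m) walks v u k Y.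
Let h Y := \sum_X g X * mu X Y.

Let S0 : set0 \in S.
Proof. by rewrite in_set Z0 /mass big_set0 ler0n. Qed.

Let walks_m Y : walks v u m Y = 0.
Proof.
rewrite /walks big1 // => F _; apply/eqP; apply/negPn/negP; rewrite mulf_eq0 negb_or.
case/andP=> v0 /prodf_neq0 u0; apply: (m_long (F := F)) => i; last first.
  by have := u0 i isT; rewrite /u; case: (_ \proper _) => //; rewrite andbF mul0r eqxx.
have Z1 (j : 'I_m) : F (lift ord0 j) \in Z.
  have : F (lift ord0 j) \in S.
    by move: (u0 j isT); rewrite /u; case: (_ \in S) => //=; rewrite mul0r eqxx.
  by rewrite in_S => /andP[].
case: (unliftP ord0 i) => [j ->//|->].
by move: v0; rewrite /v; case: (F ord0 =P set0) => [-> _|]; rewrite ?eqxx.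
Qed.

Let gE Y : g Y = v Y + \sum_X g X * u 0 X Y.
Proof.
have sumE n : \sum_(k < n.+1) walks v u k Y = v Y + \sum_(k < n) \sum_X walks v u k X * u 0 X Y.
  by rewrite big_ord_recl walks0; congr (_ + _); apply: eq_bigr => k _; rewrite walksS.
have := sumE m; rewrite big_ord_recr /= walks_m addr0 exchange_big /= /g => ->.
by congr (_ + _); apply: eq_bigr => X _; rewrite mulr_suml.
Qed.

Let g_out Y : Y \notin S -> g Y = 0.
Proof.
move=> YS; rewrite gE big1 => [|X _]; last by rewrite /u (negPf YS) mul0r mulr0.
by rewrite /v; case: eqP YS => [->|]; rewrite ?S0 ?addr0.
Qed.

Let h_in Y : Y \in S -> h Y = (Y == set0)%:R.
Proof.
move=> YS; rewrite /h (bigD1 Y) //= mobius_refl mulr1 gE (bigD1 Y) //=.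
rewrite /u properxx andbF mul0r mulr0 add0r -addrA -big_split big1 ?addr0 //= => X XY.
rewrite YS /= properEneq XY /=; case: (boolP (X \subset Y)) => [_|/mobius_nsub->].
  by rewrite mul1r mulrN addNr.
by rewrite !mulr0 addr0.
Qed.

Let gh Y : Y \in Z -> g Y = \sum_(W in Z | W \subset Y) h W.
Proof.
move=> YZ; rewrite exchange_big /= (bigD1 Y) //= -mulr_sumr sum_mobius // eqxx mulr1.
rewrite big1 ?addr0 // => X /negPf XY.
by rewrite -mulr_sumr sum_mobius // XY mulr0.
Qed.

(** The signed chain count [g] vanishes on the flats violated by [x], and so does
    its Mobius transform [h] on those of them that are not below a most violated flat
    [G]: the largest cyclic flat in [Y :&: G] is again violated, by submodularity.
    Hence summing [h] over all flats gives the same value as summing it over the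
    flats below [G], namely [g G = 0]. *)
Lemma signed_chain_count : g setT = (Z \subset S)%:R.
Proof.
case: (boolP (Z \subset S)) => [/subsetP ZS|/subsetPn[F0 F0Z F0S]].
  rewrite gh // (bigD1 set0) /= ?Z0 ?sub0set // h_in // eqxx big1 ?addr0 // => X.
  by move=> /andP[/andP[XZ _] /negPf X0]; rewrite h_in ?ZS // X0.
(* A most violated set can be taken to be a cyclic flat. *)
have [G GZ minG] : exists2 G, G \in Z & forall A, slack G <= slack A.
  case: (arg_minP slack Z0) => G GZ minG; exists G => // A.
  have [F FZ] := slack_cyclic M A x01; apply: le_trans; exact: minG.
have G_out : slack G < 0.
  by apply: le_lt_trans (minG F0) _; rewrite ltNge; move: F0S; rewrite in_S F0Z.
have h_out Y : Y \in Z -> ~~ (Y \subset G) -> h Y = 0.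
  have [n] := ubnP #|Y|; elim: n Y => // n IHn Y; rewrite ltnS => ltn YZ YG.
  have [YS|YS] := boolP (Y \in S).
    by rewrite h_in //; case: eqP YG => // ->; rewrite sub0set.
  have flI : flat M (Y :&: G).
    by apply: flatI; [move: YZ|move: GZ]; rewrite inE => /andP[].
  have [K [KZ sK rK maxK]] := flat_cyclic_part flI.
  have K_out : K \notin S.
    rewrite in_S KZ -ltNge; apply: le_lt_trans (slack_removed sK rK) _.
    have := slack_submod Y G; have := minG (Y :|: G).
    by move: YS; rewrite in_S YZ -ltNge; lra.
  have := gh YZ; rewrite g_out // (bigD1 Y) /= ?YZ ?subxx //.
  rewrite (bigID (fun W => W \subset G)) /= [X in _ + (_ + X)]big1 => [|W]; last first.
    move=> /andP[/andP[/andP[WZ sWY] WY] WG]; apply: IHn => //.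
    by apply: leq_trans ltn; apply: proper_card; rewrite properEneq WY.
  rewrite (eq_bigl (fun W => (W \in Z) && (W \subset K))) => [|W].
    by rewrite -(gh KZ) (g_out K_out) !addr0.
  apply/idP/idP => [/andP[/andP[/andP[WZ sWY] _] sWG]|/andP[WZ sWK]].
    by rewrite WZ maxK // subsetI sWY.
  have := subset_trans sWK sK; rewrite subsetI WZ => /andP[-> sWG].
  by rewrite sWG /= andbT; apply: contraNneq YG => <-.
rewrite gh // (bigID (fun W => W \subset G)) /= [X in _ + X]big1 => [|W]; last first.
  by move=> /andP[/andP[WZ _]]; apply: h_out.
rewrite addr0 (eq_bigl (fun W => (W \in Z) && (W \subset G))) => [|W].
  by rewrite -(gh GZ) g_out // in_S GZ -ltNge.
by rewrite subsetT andbT.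
Qed.

End PolytopeIdentity.

(** * Chains of cyclic flats and their Schubert matroids *)

Lemma prodr_nat_bool (I : finType) (b : pred I) : \prod_i (b i)%:R = [forall i, b i]%:R :> int.
Proof.
case: (boolP [forall i, b i]) => [/forallP all|].
  by rewrite big1 // => i _; rewrite all.
rewrite negb_forall => /existsP[i /negPf bi].
by rewrite (bigD1 i) //= bi mul0r.
Qed.

Lemma indicator_asbool (V : Type) (A : set V) (y : V) : \1_A y = `[< A y >]%:R :> int.
Proof. by rewrite indicE. Qed.

Lemma proper_chain (T : finType) k (F : 'I_k.+1 -> {set T}) :
  (forall i : 'I_k, F (widen_ord (leqnSn k) i) \proper F (lift ord0 i)) ->
  forall i j : 'I_k.+1, (i < j)%N -> F i \proper F j.
Proof.
move=> step i j; have [n jn] : exists n, n = j :> nat by exists j.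
elim: n j jn => [|n IHn] j jn ij; first by rewrite -jn in ij.
case: (unliftP ord0 j) jn ij => [j' ->|->] //; rewrite lift0 => -[nj'] ij.
have s := step j'; have : (i <= widen_ord (leqnSn k) j')%N by [].
rewrite leq_eqVlt => /orP[/eqP/val_inj-> //|lt].
by apply: proper_trans s; apply: IHn.
Qed.

Section FlatChains.
Variables (T : finType) (M : matroid T).
Notation Z := (cyclic_flats M).
Hypotheses (Z0 : set0 \in Z) (ZT : setT \in Z).

Section OneChain.
Variables (k : nat) (F : {ffun 'I_k.+1 -> {set T}}).

Definition flat_chain : bool :=
  [&& F ord0 == set0, F ord_max == setT, [forall i, F i \in Z] &
      [forall i : 'I_k, F (widen_ord (leqnSn k) i) \proper F (lift ord0 i)]].

Definition flat_chain_coeff : int :=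
  \prod_(i < k) - mobius Z (F (widen_ord (leqnSn k) i)) (F (lift ord0 i)).

Definition chain_flats : {set {set T}} := [set F i | i : 'I_k.+1].

Lemma chain_flats_total : flat_chain ->
  forall X Y, X \in chain_flats -> Y \in chain_flats -> (X \subset Y) || (Y \subset X).
Proof.
case/and4P=> _ _ _ /forallP/proper_chain lt _ _ /imsetP[i _ ->] /imsetP[j _ ->].
case: (ltngtP i j) => [/lt/proper_sub->//|/lt/proper_sub->|/val_inj->]; rewrite ?orbT //.
by rewrite subxx.
Qed.

Lemma chain_flats0 : flat_chain -> set0 \in chain_flats.
Proof. by case/and4P=> /eqP F0 _ _ _; rewrite -F0 imset_f. Qed.

Lemma chain_flatsT : flat_chain -> setT \in chain_flats.
Proof. by case/and4P=> _ /eqP FT _ _; rewrite -FT imset_f. Qed.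

Lemma chain_flats_cyclic : flat_chain -> {subset chain_flats <= Z}.
Proof. by case/and4P=> _ _ /forallP FZ _ X /imsetP[i _ ->]. Qed.

(** Outside chains of flats the value is arbitrary. *)
Definition flat_schubert : matroid T :=
  match @idP flat_chain with
  | ReflectT c => chain_matroid M (chain_flats_total c) (chain_flats0 c)
  | ReflectF _ => M
  end.

Lemma flat_schubert_cyclic : flat_chain -> cyclic_flats flat_schubert = chain_flats.
Proof.
rewrite /flat_schubert => FC; case: {-}_ / idP => // c.
by apply: cyclic_flats_chain (chain_flats_cyclic FC); apply: chain_flatsT.
Qed.

Lemma flat_schubert_rank i : flat_chain -> rank flat_schubert (F i) = rank M (F i).
Proof.
rewrite /flat_schubert => FC; case: {-}_ / idP => // c.
by apply: rank_chain_matroid; apply: imset_f.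
Qed.

Lemma flat_schubertP : flat_chain -> schubert flat_schubert.
Proof. by move=> FC X Y; rewrite !flat_schubert_cyclic //; apply: chain_flats_total. Qed.

Lemma flat_schubert_polytope (R : realType) (x : {ffun T -> R}) : flat_chain ->
  base_polytope flat_schubert x <->
  [/\ forall e, 0 <= x e <= 1, mass x setT = (rank M setT)%:R
    & forall i, mass x (F i) <= (rank M (F i))%:R].
Proof.
move=> FC; have FT : F ord_max = setT by case/and4P: FC => _ /eqP.
have rT : rank flat_schubert setT = rank M setT by rewrite -FT flat_schubert_rank.
split=> [/base_polytopeP[x01 xT le]|[x01 xT le]].
  split=> // [|i]; first by rewrite xT rT.
  by rewrite -flat_schubert_rank // le // flat_schubert_cyclic // imset_f.
apply/base_polytopeP; rewrite rT; split=> // G; rewrite flat_schubert_cyclic //.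
by case/imsetP=> i _ ->; rewrite flat_schubert_rank.
Qed.

End OneChain.

(** The base polytope of [M] and those of the Schubert matroids of chains of flats
    are cut out of the same hypersimplex by rank inequalities, so that at a point [x]
    only the chains of flats that [x] does not violate contribute. *)
Lemma flat_chain_indicator (R : realType) m (x : {ffun T -> R}) :
  (forall F : 'I_m.+1 -> {set T}, (forall i, F i \in Z) ->
    ~ forall i : 'I_m, F (widen_ord (leqnSn m) i) \proper F (lift ord0 i)) ->
  \sum_(k < m) \sum_(F : {ffun 'I_k.+1 -> {set T}} | flat_chain F)
     flat_chain_coeff F * \1_(base_polytope (flat_schubert F)) x
  = \1_(base_polytope M) x :> int.
Proof.
move=> long; rewrite indicator_asbool.
have [[x01 xT]|out] := pselect ((forall e, 0 <= x e <= 1) /\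
    mass x setT = (rank M setT)%:R); last first.
  rewrite asboolF; last by move=> /base_polytopeP[x01 xT _]; apply: out.
  rewrite big1 // => k _; rewrite big1 // => F FC.
  rewrite indicator_asbool asboolF; first exact: mulr0.
  by case/(flat_schubert_polytope _ FC) => x01 xT _; apply: out.
have -> : `[< base_polytope M x >] = (Z \subset [set X in Z | mass x X <= (rank M X)%:R]).
  apply/asboolP/subsetP => [/base_polytopeP[_ _ le] X XZ|sub].
    by rewrite in_set XZ le.
  by apply/base_polytopeP; split=> // X /sub; rewrite in_set => /andP[].
rewrite -(signed_chain_count Z0 ZT x01 long); apply: eq_bigr => k _.
rewrite /walks [LHS]big_mkcond [RHS]big_mkcond; apply: eq_bigr => F _.
rewrite /walk_weight big_split /= prodr_nat_bool -/(flat_chain_coeff F).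
set b := [forall i, _]; rewrite mulrA -natrM mulnb.
have eqb : (F ord_max == setT) && ((F ord0 == set0) && b)
    = flat_chain F && [forall i, mass x (F i) <= (rank M (F i))%:R].
  apply/idP/idP.
    case/and3P=> FT /eqP F0 /forallP Fb.
    have FS i : F i \in [set X in Z | mass x X <= (rank M X)%:R].
      case: (unliftP ord0 i) => [j|] ->; first by case/andP: (Fb j).
      by rewrite F0 in_set Z0 /mass big_set0 ler0n.
    rewrite /flat_chain F0 eqxx FT /=; apply/andP; split.
      apply/andP; split; apply/forallP => i; last by case/andP: (Fb i).
      by have := FS i; rewrite in_set => /andP[].
    by apply/forallP => i; have := FS i; rewrite in_set => /andP[].
  case/andP=> /and4P[-> -> /forallP FZ /forallP lt] /forallP le /=.
  by apply/forallP => i; rewrite in_set FZ le lt.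
transitivity ((flat_chain F && [forall i, mass x (F i) <= (rank M (F i))%:R])%:R
    * flat_chain_coeff F).
  case: (boolP (flat_chain F)) => [FC|]; last by rewrite mul0r.
  rewrite indicator_asbool mulrC /=; congr ((nat_of_bool _)%:R * _).
  apply/idP/idP => [/asboolP/(flat_schubert_polytope _ FC)[_ _ le]|/forallP le].
    exact/forallP.
  exact/asboolP/(flat_schubert_polytope _ FC).
by rewrite -eqb; case: eqP => [_|_] /=; rewrite ?mul0r.
Qed.

End FlatChains.

(** * The incidence matrix of a condensation *)

(** In the Leibniz formula only the identity contributes: a permutation all of whose
    entries are nonzero cannot decrease [h] anywhere, hence preserves it. *)
Lemma unitriangular_unitmx (R : comUnitRingType) n (A : 'M[R]_n) (h : 'I_n -> nat) :
  (forall i, A i i = 1) -> (forall i j, A i j != 0 -> i != j -> (h i < h j)%N) ->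
  A \in unitmx.
Proof.
move=> A1 Ah; rewrite unitmxE; suff -> : \det A = 1 by apply: unitr1.
rewrite /determinant (bigD1 (1%g : {perm 'I_n})) //= odd_perm1 expr0 mul1r.
rewrite big1 => [|i _]; last first.
  by rewrite perm1.
rewrite big1 ?addr0 // => s s1; apply/eqP; apply: contraNT s1 => nz.
have {}nz i : A i (s i) != 0.
  apply: contraNneq nz => Ai; rewrite (bigD1 i) //= Ai mul0r mulr0 //.
have le i : (h i <= h (s i))%N.
  by have [<-//|ne] := eqVneq i (s i); apply/ltnW/Ah.
have eqh : (\sum_i h (s i) = \sum_i h i)%N by rewrite [RHS](reindex_inj (@perm_inj _ s)).
apply/eqP/permP => i; rewrite perm1; apply/eqP; apply: contraTT isT => ne.
have lt : (h i < h (s i))%N by apply: Ah; rewrite // eq_sym.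
suff : (\sum_i h i < \sum_i h (s i))%N by rewrite eqh ltnn.
rewrite (bigD1 i) //= [X in (_ < X)%N](bigD1 i) //= -addSn leq_add //.
by apply: leq_sum => j _.
Qed.

Section Blocks.
Variables (T : finType) (M : matroid T).
Hypotheses (Ml : forall e, ~~ loop M e) (Mc : forall e, ~~ coloop M e).
Variables (P : {set {set {set T}}}) (HP : condensation M P).
Notation Z := (cyclic_flats M).
Notation K := (configuration_of Ml Mc HP).
Notation mu := (mobius Z).
Implicit Types (X Y W : {set T}) (B C D : block K).

Definition block_of X : block K := insubd (hat0 K) (pblock P X).

Let coverP : cover P = Z.
Proof. by case/and3P: (cond_partition HP) => /eqP. Qed.

Let trivP : trivIset P.
Proof. by case/and3P: (cond_partition HP). Qed.

Lemma block_flat B X : X \in val B -> X \in Z.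
Proof. by move=> XB; rewrite -coverP; apply/bigcupP; exists (val B); rewrite ?(valP B). Qed.

Lemma mem_block X B : X \in Z -> (X \in val B) = (block_of X == B).
Proof.
rewrite -coverP => XZ; rewrite -val_eqE /= insubdK; last exact: pblock_mem.
apply/idP/eqP => [XB|<-]; last by rewrite mem_pblock.
exact: def_pblock (valP B) XB.
Qed.

Lemma block_of_mem X B : X \in val B -> block_of X = B.
Proof. by move=> XB; apply/eqP; rewrite -mem_block //; apply: block_flat XB. Qed.

Lemma mem_block_of X : X \in Z -> X \in val (block_of X).
Proof. by move=> XZ; rewrite mem_block. Qed.

Lemma block_repr_mem B : block_repr (val B) \in val B.
Proof.
rewrite /block_repr; case: pickP => // none.
have /and3P[_ _] := cond_partition HP; case/negP.
suff <- : val B = set0 by exact: (valP B).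
by apply/setP => X; rewrite inE; apply: none.
Qed.

Lemma bsize_card B X : X \in val B -> bsize B = #|X|.
Proof. exact: (cond_card HP (valP B) (block_repr_mem B)). Qed.

Lemma brank_rank B X : X \in val B -> brank B = rank M X.
Proof. exact: (cond_rank HP (valP B) (block_repr_mem B)). Qed.

Lemma binc_card B C Y : Y \in val C -> binc B C = #|[set X in val B | X \subset Y]|.
Proof. exact: (cond_inc HP (valP B) (valP C) (block_repr_mem C)). Qed.

Lemma binc_gt0 B C Y : Y \in val C ->
  (0 < binc B C)%N -> exists2 X, X \in val B & X \subset Y.
Proof.
move=> YC; rewrite (binc_card _ YC) => /card_gt0P[X]; rewrite inE => /andP[XB sXY].
by exists X.
Qed.

(** Distinct comparable blocks have flats of different sizes. *)
Lemma inc_mx_unit : inc_mx K \in unitmx.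
Proof.
apply: (@unitriangular_unitmx _ _ _ (fun i => bsize (enum_val i : block K))) => [i|i j].
  set B := enum_val i; rewrite mxE (binc_card _ (block_repr_mem B)).
  suff -> : [set X in val B | X \subset block_repr (val B)] = [set block_repr (val B)].
    by rewrite cards1.
  apply/setP => X; rewrite !inE; apply/andP/eqP => [[XB sX]|->].
    apply/eqP; rewrite eqEcard sX.
    by rewrite -(bsize_card XB) (bsize_card (block_repr_mem B)) leqnn.
  by rewrite block_repr_mem subxx.
rewrite mxE -[0]/(Posz 0) eqz_nat -lt0n => inc ij.
set B := enum_val i in inc *; set C := enum_val j in inc *.
have YC := block_repr_mem C; have [X XB sXY] := binc_gt0 YC inc.
rewrite (bsize_card XB) (bsize_card YC) proper_card // properEneq sXY andbT.
apply: contraNneq ij => eXY; apply/eqP/enum_val_inj.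
by rewrite -/B -/C -(block_of_mem XB) eXY (block_of_mem YC).
Qed.

Lemma inv_inc_mul B D : \sum_(C : block K) inv_inc B C * (binc C D)%:Z = (B == D)%:R.
Proof.
have := congr1 (fun A : 'M_ _ => A (enum_rank B) (enum_rank D)) (mulVmx inc_mx_unit).
rewrite !mxE (inj_eq enum_rank_inj) => <-.
rewrite (reindex_onto (@enum_rank _) (@enum_val _ _)) => [|i _]; last exact: enum_valK.
apply: eq_big => [C|C _]; first by rewrite enum_rankK eqxx.
by rewrite /inv_inc mxE !enum_rankK.
Qed.

(** Both sides have the same sums over the flats below any flat [Y]: [B == block_of Y]. *)
Lemma sum_mobius_block B Y : Y \in Z -> \sum_(X in val B) mu X Y = inv_inc B (block_of Y).
Proof.
have [n] := ubnP #|Y|; elim: n Y => // n IHn Y; rewrite ltnS => ltn YZ.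
have sum1 : \sum_(W in Z | W \subset Y) \sum_(X in val B) mu X W = (block_of Y == B)%:R.
  rewrite exchange_big /= (eq_bigr (fun X => (X == Y)%:R)) => [|X _]; last exact: sum_mobius.
  rewrite -mem_block //; case: (boolP (Y \in val B)) => [YB|YB].
    by rewrite (bigD1 Y) //= eqxx big1 ?addr0 // => X /andP[_ /negPf->].
  by rewrite big1 // => X XB; case: eqP YB => // <-; rewrite XB.
have sum2 : \sum_(W in Z | W \subset Y) inv_inc B (block_of W) = (block_of Y == B)%:R.
  rewrite eq_sym -inv_inc_mul (partition_big block_of xpredT) //; apply: eq_bigr => C _.
  rewrite (binc_card _ (mem_block_of YZ)) (eq_bigr (fun=> inv_inc B C)); last first.
    by move=> W /andP[_ /eqP->].
  rewrite sumr_const -mulr_natr natz; congr (_ * _%:Z); apply: eq_card => W.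
  rewrite [RHS]inE unfold_in /=.
  case: (boolP (W \in Z)) => [WZ|WZ]; first by rewrite -(mem_block _ WZ) andbC.
  by apply/esym/negP => /andP[/block_flat]; rewrite (negPf WZ).
move: sum1; rewrite -sum2 !(bigD1 Y (P := fun W => (W \in Z) && _)) ?YZ ?subxx //=.
rewrite [X in _ + X = _](eq_bigr (fun W => inv_inc B (block_of W))); first exact: addIr.
move=> W /andP[/andP[WZ sWY] WY]; apply: IHn => //; apply: leq_trans ltn.
by apply: proper_card; rewrite properEneq WY.
Qed.

(** By [sum_mobius_block], summing over the first flat of a chain yields a factor that
    only depends on the block of the next one. *)
Lemma block_chain_walks (B : nat -> block K) k Y :
  walks (fun X => (X \in val (B 0%N))%:R)
    (fun i X Y => (Y \in val (B i.+1))%:R * - mu X Y) k Y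
  = (Y \in val (B k))%:R * \prod_(i < k) - inv_inc (B i) (B i.+1).
Proof.
elim: k Y => [|k IHk] Y; first by rewrite walks0 big_ord0 mulr1.
rewrite walksS; under eq_bigr do rewrite IHk.
case: (boolP (Y \in val (B k.+1))) => [YB|_]; last first.
  by rewrite mul0r big1 // => X _; rewrite mul0r mulr0.
rewrite mul1r big_ord_recr /= -(block_of_mem YB) -sum_mobius_block ?(block_flat YB) //.
rewrite -sumrN mulr_sumr [RHS]big_mkcond; apply: eq_bigr => X _.
by rewrite mul1r; case: (X \in _); rewrite ?mul1r ?mul0r.
Qed.

Section OneChain.
Variable k : nat.
Implicit Types (F : {ffun 'I_k.+1 -> {set T}}) (Bs : {ffun 'I_k.+1 -> block K}).

Definition chain_type F : {ffun 'I_k.+1 -> block K} := [ffun i => block_of (F i)].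

Lemma hat0E : val (hat0 K) = [set set0]. Proof. by []. Qed.
Lemma hat1E : val (hat1 K) = [set setT]. Proof. by []. Qed.

Lemma flat_chain_type F : flat_chain M F -> block_chain (chain_type F).
Proof.
case/and4P=> /eqP F0 /eqP FT /forallP FZ /forallP lt; rewrite /block_chain !ffunE.
rewrite F0 FT (@block_of_mem set0 (hat0 K)) ?hat0E ?inE // eqxx.
rewrite (@block_of_mem setT (hat1 K)) ?hat1E ?inE // eqxx /=.
apply/forallP => i; rewrite !ffunE /block_lt.
set X : {set T} := F _; set Y : {set T} := F _.
have XB : X \in val (block_of X) by apply/mem_block_of/FZ.
have YB : Y \in val (block_of Y) by apply/mem_block_of/FZ.
apply/andP; split.
  apply: contraTneq (proper_card (lt i)) => eXY; rewrite -leqNgt -/X -/Y.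
  by rewrite -(bsize_card XB) eXY (bsize_card YB).
rewrite (binc_card _ YB); apply/card_gt0P; exists X; rewrite inE XB.
exact: proper_sub (lt i).
Qed.

(** A sequence of flats of the blocks [Bs i] that is not increasing has weight 0, as the
    Mobius function vanishes on pairs not comparable in this order. *)
Lemma sum_flat_chain_coeff Bs : block_chain Bs ->
  \sum_(F | flat_chain M F && (chain_type F == Bs)) flat_chain_coeff M F = chain_coeff Bs.
Proof.
move=> /and3P[/eqP B0 /eqP BT /forallP ltB].
pose Bn i := Bs (inord i).
have BnE (i : 'I_k.+1) : Bn i = Bs i by rewrite /Bn inord_val.
have BnS (i : 'I_k) : Bn i.+1 = Bs (lift ord0 i) by rewrite -BnE lift0.
have BnW (i : 'I_k) : Bn i = Bs (widen_ord (leqnSn k) i) by rewrite -BnE.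
have := block_chain_walks Bn k setT.
have -> : Bn k = Bs ord_max by rewrite -BnE.
rewrite BT hat1E inE eqxx mul1r; under [X in _ = X]eq_bigr do rewrite BnS BnW.
rewrite -/(chain_coeff Bs) => <-.
rewrite /walks [LHS]big_mkcond [RHS]big_mkcond; apply: eq_bigr => F _.
rewrite /walk_weight big_split /= prodr_nat_bool -/(flat_chain_coeff M F) mulrA -natrM mulnb.
have in_blocks : (F ord0 \in val (Bn 0%N)) && [forall i : 'I_k, F (lift ord0 i) \in val (Bn i.+1)]
    = [forall i, F i \in val (Bs i)].
  apply/andP/forallP => [[F0 /forallP FB] i|FB]; last first.
    by split; [rewrite (BnE ord0)|apply/forallP => i; rewrite BnS].
  by case: (unliftP ord0 i) => [j|] ->; rewrite -?BnS // -BnE.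
rewrite in_blocks.
case: (boolP [forall i, F i \in val (Bs i)]) => [/forallP FB|FB]; last first.
  rewrite mul0r if_same; case: ifP => // /andP[FC /eqP eB]; case/negP: FB.
  apply/forallP => i; rewrite -eB ffunE mem_block_of //.
  by case/and4P: FC => _ _ /forallP.
have eB : chain_type F = Bs by apply/ffunP => i; rewrite ffunE (block_of_mem (FB i)).
rewrite eB eqxx andbT mul1r.
have F0 : F ord0 = set0 by apply/eqP; have := FB ord0; rewrite B0 hat0E inE.
have FT : F ord_max = setT by apply/eqP; have := FB ord_max; rewrite BT hat1E inE.
rewrite FT eqxx; case: ifP => // /negbT; rewrite /flat_chain F0 FT !eqxx /= negb_and.
case/orP => /forallPn[i]; first by rewrite (block_flat (FB i)).
move=> nlt; rewrite /flat_chain_coeff (bigD1 i) //= mobius_nsub ?oppr0 ?mul0r //.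
apply: contra nlt; rewrite properEneq => ->; rewrite andbT.
have /andP[+ _] := ltB i; apply: contraNneq => eF.
by rewrite -(block_of_mem (FB _)) eF (block_of_mem (FB _)).
Qed.

End OneChain.

(** Sizes increase along a chain of flats, so it meets each block at most once. *)
Lemma no_long_chain (F : 'I_#|block K|.+1 -> {set T}) : (forall i, F i \in Z) ->
  ~ forall i : 'I_#|block K|, F (widen_ord (leqnSn _) i) \proper F (lift ord0 i).
Proof.
move=> FZ /proper_chain lt.
suff inj : injective (fun i => block_of (F i)).
  by have := leq_card _ inj; rewrite card_ord ltnn.
have neq (i j : 'I_#|block K|.+1) : (i < j)%N -> block_of (F i) <> block_of (F j).
  move=> ij eB; have := proper_card (lt _ _ ij).
  by rewrite -(bsize_card (mem_block_of (FZ i))) eB (bsize_card (mem_block_of (FZ j))) ltnn.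
move=> i j eB; apply: val_inj; case: (ltngtP i j) => // ij.
  by case: (neq _ _ ij).
by case: (neq _ _ ij).
Qed.

End Blocks.

(** * The expansion over block chains *)

Lemma matroid_transport (T U : finType) (M : matroid T) (f : T -> U) : bijective f ->
  exists N : matroid U, forall B : {set T}, (f @: B \in bases N) = (B \in bases M).
Proof.
move=> bf; have fI := bij_inj bf.
pose Bs := [set f @: B | B : {set T} in bases M].
have BsE (B : {set T}) : (f @: B \in Bs) = (B \in bases M).
  by apply: mem_imset; apply: imset_inj.
have Bs0 : Bs != set0.
  have /set0Pn[B BM] := bases_neq0 M; by apply/set0Pn; exists (f @: B); rewrite BsE.
have fU1D1 (B : {set T}) x y : f y |: (f @: B :\ f x) = f @: (y |: (B :\ x)).
  rewrite imsetU1; congr (_ |: _); apply/setP => u.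
  have [g fK gK] := bf; rewrite -(gK u) !(inE, mem_imset) //.
  by rewrite (inj_eq fI).
suff BsX : forall B1 B2 : {set U}, B1 \in Bs -> B2 \in Bs -> forall x, x \in B1 :\: B2 ->
    exists2 y, y \in B2 :\: B1 & y |: (B1 :\ x) \in Bs.
  by exists (Matroid Bs0 BsX).
move=> _ _ /imsetP[C1 C1M ->] /imsetP[C2 C2M ->] x.
rewrite inE => /andP[xC2 /imsetP[z zC1 ex]]; rewrite ex (mem_imset _ _ fI) in xC2 *.
have [|y yD yM] := bases_exchange C1M C2M (x := z); first by rewrite inE xC2.
exists (f y); last by rewrite fU1D1 BsE.
by move: yD; rewrite !inE !mem_imset.
Qed.

Lemma card_ord_bij (T : finType) n : #|T| = n -> exists f : T -> 'I_n, bijective f.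
Proof.
move=> eT; exists (cast_ord eT \o enum_rank).
exists (enum_val \o cast_ord (esym eT)) => i /=; first by rewrite cast_ordK enum_rankK.
by rewrite enum_valK cast_ordKV.
Qed.

Section SchubertOfBlocks.
Variables (T : finType) (M : matroid T).
Hypotheses (Ml : forall e, ~~ loop M e) (Mc : forall e, ~~ coloop M e).
Variables (P : {set {set {set T}}}) (HP : condensation M P).
Notation K := (configuration_of Ml Mc HP).

Lemma bsize_hat1 : bsize (hat1 K) = #|T|.
Proof. by rewrite (@bsize_card _ _ _ _ _ _ _ setT) ?cardsT // hat1E inE. Qed.

(** The transport of [flat_schubert M F] to the standard ground set satisfies [is_Sch];
    so [Sch] does as well, and sizes and ranks determine a Schubert matroid. *)
Lemma Sch_isomorphic k (F : {ffun 'I_k.+1 -> {set T}}) : flat_chain M F ->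
  isomorphic (flat_schubert M F) (Sch (chain_type Ml Mc HP F)).
Proof.
move=> FC; set B := chain_type _ _ _ F.
have cardT : #|T| = #|'I_(bsize (hat1 K))| by rewrite card_ord bsize_hat1.
have FZ i : F i \in cyclic_flats M by case/and4P: FC => _ _ /forallP.
have FB i : F i \in val (B i) by rewrite ffunE mem_block_of.
have : exists S, is_Sch B S.
  have [f bf] := card_ord_bij (esym bsize_hat1).
  have [N NB] := matroid_transport (flat_schubert M F) bf.
  have fI := bij_inj bf.
  exists N, (fun i => f @: F i); split=> [X|i j ij|i].
  - have [Y ->] := imset_bij_inv bf X; rewrite (cyclic_flats_iso bf NB) flat_schubert_cyclic //.
    split=> [/imsetP[i _ ->]|[i /(imset_inj fI)->]]; first by exists i.
    exact: imset_f.
  - case/and4P: FC => _ _ _ /forallP/proper_chain/(_ i j ij).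
    by rewrite !properEneq (inj_eq (imset_inj fI)) (imset_bijS bf).
  - rewrite (card_imset _ fI) (rank_iso bf NB) flat_schubert_rank //.
    by rewrite -(bsize_card (FB i)) -(brank_rank (FB i)).
move/(xgetPex (free_matroid _)); rewrite -/(Sch B) => -[F' [F'Z F'lt F'B]].
apply: schubert_isomorphic => //.
- exact: flat_schubertP.
- move=> X Y /F'Z[i ->] /F'Z[j ->].
  case: (ltngtP i j) => [/F'lt/proper_sub->//|/F'lt/proper_sub->|/val_inj->]; rewrite ?orbT //.
  by rewrite subxx.
- move=> G; rewrite flat_schubert_cyclic // => /imsetP[i _ ->].
  exists (F' i); first by apply/F'Z; exists i.
  by rewrite flat_schubert_rank // (F'B i).1 (F'B i).2 (bsize_card (FB i)) (brank_rank (FB i)).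
- move=> H /F'Z[i ->]; exists (F i); first by rewrite flat_schubert_cyclic // imset_f.
  by rewrite flat_schubert_rank // (F'B i).1 (F'B i).2 (bsize_card (FB i)) (brank_rank (FB i)).
Qed.

(** Grouping the chains of flats by the blocks that they run through. *)
Lemma sum_block_chains (A : zmodType) (Phi : forall U : finType, matroid U -> A) :
  (forall (U V : finType) (N : matroid U) (L : matroid V), isomorphic N L -> Phi U N = Phi V L) ->
  \sum_(k < #|block K|) \sum_(B : {ffun 'I_k.+1 -> block K} | block_chain B)
    Phi _ (Sch B) *~ chain_coeff B
  = \sum_(k < #|block K|) \sum_(F : {ffun 'I_k.+1 -> {set T}} | flat_chain M F)
    Phi _ (flat_schubert M F) *~ flat_chain_coeff M F.
Proof.
move=> Phi_iso; apply: eq_bigr => k _.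
rewrite [RHS](partition_big (@chain_type _ _ Ml Mc _ HP k) (@block_chain K k)) /=; last first.
  exact: flat_chain_type.
apply: eq_bigr => B BC; rewrite -(sum_flat_chain_coeff BC) mulrz_sumr.
apply: eq_bigr => F /andP[FC /eqP eB]; congr (_ *~ _).
by rewrite -eB; apply/esym/Phi_iso/Sch_isomorphic.
Qed.

End SchubertOfBlocks.

Section Relation.
Variable R : realType.

Variables (T : finType) (M : matroid T).
Hypotheses (Ml : forall e, ~~ loop M e) (Mc : forall e, ~~ coloop M e).
Variables (P : {set {set {set T}}}) (HP : condensation M P).
Notation K := (configuration_of Ml Mc HP).

(** The identity of indicator functions of [flat_chain_indicator] as a valuative
    relation; the second part evaluates its left-hand side for any function [f] of
    matroids, both invariants and isomorphism classes being needed. *)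
Lemma flat_chain_relation : exists n (N : 'I_n -> matroid T) (a : 'I_n -> int),
  polytope_relation R N a /\
  forall (A : zmodType) (f : matroid T -> A), \sum_(i < n) f (N i) *~ a i =
    f M - \sum_(k < #|block K|) \sum_(F : {ffun 'I_k.+1 -> {set T}} | flat_chain M F)
      f (flat_schubert M F) *~ flat_chain_coeff M F.
Proof.
pose I : finType := (unit + {k : 'I_#|block K| & {ffun 'I_k.+1 -> {set T}}})%type.
pose N (i : I) : matroid T := match i with inl _ => M | inr p => flat_schubert M (tagged p) end.
pose a (i : I) : int := match i with inl _ => 1
  | inr p => if flat_chain M (tagged p) then - flat_chain_coeff M (tagged p) else 0 end.
have sumE (A : zmodType) (f : matroid T -> A) :
    \sum_(i : 'I_#|I|) f (N (enum_val i)) *~ a (enum_val i) =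
    f M - \sum_(k < #|block K|) \sum_(F : {ffun 'I_k.+1 -> {set T}} | flat_chain M F)
      f (flat_schubert M F) *~ flat_chain_coeff M F.
  rewrite -(reindex (@enum_val _ (mem I)) (P := xpredT)
    (F := fun i : I => f (N i) *~ a i)); last first.
    by apply: onW_bij; apply: enum_val_bij.
  rewrite big_sumType /= (big_pred1 tt) //=; congr (_ + _).
  rewrite -sumrN; under [RHS]eq_bigr do rewrite -sumrN big_mkcond.
  rewrite sig_big_dep /=; apply: eq_bigr => -[k F] _ /=.
  by case: ifP => _; rewrite ?mulr0z // mulrNz.
exists #|I|, (fun i => N (enum_val i)), (fun i => a (enum_val i)); split=> // x.
transitivity (\sum_(i : 'I_#|I|) \1_(base_polytope (N (enum_val i))) x *~ a (enum_val i) : int).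
  by apply: eq_bigr => i _; rewrite mulrzz mulrC.
rewrite (sumE int (fun L => \1_(base_polytope L) x)); apply/eqP; rewrite subr_eq0; apply/eqP/esym.
rewrite -(flat_chain_indicator (cyclic_flat0 Ml) (cyclic_flatT Mc) x
  (@no_long_chain _ _ Ml Mc _ HP)).
by apply: eq_bigr => k _; apply: eq_bigr => F _; rewrite mulrzz mulrC.
Qed.

End Relation.

(** * The Euler characteristic of compact convex sets *)

Section EulerCharacteristic.
Variable R : realType.
Local Open Scope classical_set_scope.

Definition convex_real (A : set R) : Prop :=
  forall s t u, A s -> A u -> s <= t -> t <= u -> A t.

(** At [t], the indicator function of a compact interval jumps down to the right
    exactly when [t] is its right end; the sum of [a i] over the intervals with right
    end [t] is therefore the jump at [t] of the zero function. *)
Lemma euler_characteristic_line (I : finType) (A : I -> set R) (a : I -> int) :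
  (forall i, compact (A i)) -> (forall i, convex_real (A i)) ->
  (forall t, \sum_i a i * `[< A i t >]%:R = 0) ->
  \sum_i a i * `[< A i !=set0 >]%:R = 0.
Proof.
move=> Ac Aconv sum0.
have /choice[e eP] : forall i, exists e, A i !=set0 -> A i e /\ forall t, A i t -> t <= e.
  move=> i; have [A0|A0] := pselect (A i !=set0); last by exists 0.
  have idc : {within A i, continuous (@idfun R)} by apply: continuous_subspaceT => x; apply: cvg_id.
  have [c] := compact_EVT_max A0 (Ac i) idc.
  by rewrite in_setE => Ac' maxc; exists c => _; split=> // t; rewrite -in_setE; apply: maxc.
have ends t : \sum_(i | `[< A i !=set0 >] && (e i == t)) a i = 0.
  have near_jump i : \forall s \near t^'+,
      `[< A i s >] = `[< A i t >] && ~~ (`[< A i !=set0 >] && (e i == t)).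
    have [At|nAt] := pselect (A i t); last first.
      rewrite (asboolF nAt) /=.
      have : \forall s \near t, ~ A i s.
        apply: open_nbhs_nbhs; split=> //.
        by apply: closed_openC; apply: compact_closed => //; apply: Rhausdorff.
      move=> nA; near=> s; apply: asboolF; near: s; exact: cvg_within nA.
    have A0 : A i !=set0 by exists t.
    have [Ae maxe] := eP i A0.
    rewrite (asboolT At) (asboolT A0) /=.
    have [et|et] := eqVneq (e i) t.
      near=> s; have ts : t < s by near: s; apply: nbhs_right_gt.
      by apply: asboolF => /maxe; rewrite et => /(lt_le_trans ts); rewrite ltxx.
    have lt : t < e i by rewrite lt_neqAle eq_sym et maxe.
    near=> s; have ts : t < s by near: s; apply: nbhs_right_gt.
    have se : s < e i by near: s; apply: nbhs_right_lt.
    by apply/asboolT/(Aconv i t s (e i)) => //; apply: ltW.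
  have [s sP] := @filter_ex _ _ (at_right_proper_filter t) _ (@filter_forall _ _ _ _ _ near_jump).
  have diff : \sum_i a i * (`[< A i t >]%:R - `[< A i s >]%:R) = 0.
    by under eq_bigr do rewrite mulrBr; rewrite sumrB !sum0 subrr.
  rewrite -[RHS]diff big_mkcond; apply: eq_bigr => i _; rewrite sP.
  case: ifP => [/andP[/asboolP A0 /eqP ei]|_] /=; last by rewrite andbT subrr mulr0.
  by have [Ae _] := eP i A0; rewrite asboolT -?ei // andbF subr0 mulr1.
pose first i := odflt i [pick j | `[< A j !=set0 >] && (e j == e i)].
rewrite (eq_bigr (fun i => if `[< A i !=set0 >] then a i else 0)) => [|i _]; last first.
  by case: ifP => _; rewrite ?mulr1 ?mulr0.
rewrite -big_mkcond (partition_big first xpredT) //= big1 // => j _.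
have [[i /andP[Ai /eqP fi]]|none] :=
  pselect (exists i, `[< A i !=set0 >] && (first i == j)); last first.
  by rewrite big1 // => i ij; case: none; exists i.
rewrite -[RHS](ends (e i)); apply: eq_bigl => k; apply: andb_id2l => Ak.
have firstE l : `[< A l !=set0 >] -> e (first l) = e l.
  move=> Al; rewrite /first; case: pickP => [m /andP[_ /eqP]//|/(_ l)].
  by rewrite Al eqxx.
apply/eqP/eqP => [fk|ek]; first by rewrite -(firstE k) // fk -fi firstE.
rewrite -fi /first (eq_pick (Q := fun m => `[< A m !=set0 >] && (e m == e i))); last first.
  by move=> m; rewrite ek.
by case: pickP => // /(_ i); rewrite Ai eqxx.
Unshelve. all: by end_near.
Qed.

Definition convex_space n (K : set 'rV[R]_n) : Prop :=
  forall x y (s : R), K x -> K y -> 0 <= s -> s <= 1 -> K (s *: x + (1 - s) *: y).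

(** The coordinates are eliminated one at a time: over a fixed value of the later
    coordinates, each set projects to a compact interval on the line of the next
    one. *)
Lemma euler_characteristic n (I : finType) (K : I -> set 'rV[R]_n) (a : I -> int) :
  (forall i, compact (K i)) -> (forall i, convex_space (K i)) ->
  (forall v, \sum_i a i * `[< K i v >]%:R = 0) ->
  \sum_i a i * `[< K i !=set0 >]%:R = 0.
Proof.
move=> Kc Kconv sum0.
pose tail j (y : 'rV[R]_n) :=
  [set x : 'rV[R]_n | forall k : 'I_n, (j <= k)%N -> x ord0 k = y ord0 k].
have tail_closed j y : topology_structure.closed (tail j y).
  have -> : tail j y = \bigcap_(k in [set k : 'I_n | (j <= k)%N])
      ((fun x : 'rV[R]_n => x ord0 k) @^-1` [set t | t = y ord0 k]) by [].
  apply: closed_bigI => k _; apply: (continuous_closedP _).1; last exact: closed_eq.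
  exact: coord_continuous.
suff elim_coord j : (j <= n)%N -> forall y,
    \sum_i a i * `[< K i `&` tail j y !=set0 >]%:R = 0.
  rewrite -[RHS](elim_coord n (leqnn n) 0); apply: eq_bigr => i _; congr (_ * (nat_of_bool _)%:R).
  apply: asbool_equiv_eq; split=> [[x Kx]|[x [Kx _]]]; exists x => //; split=> // k.
  by rewrite leqNgt ltn_ord.
elim: j => [_ y|j IHj ltj y].
  rewrite -[RHS](sum0 y); apply: eq_bigr => i _; congr (_ * (nat_of_bool _)%:R).
  apply: asbool_equiv_eq; split=> [[x [Kx xy]]|Ky]; last by exists y.
  by have <- : x = y by apply/rowP => k; rewrite xy.
pose j0 := Ordinal ltj.
pose A i := (fun x : 'rV[R]_n => x ord0 j0) @` (K i `&` tail j.+1 y).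
have AE i : `[< K i `&` tail j.+1 y !=set0 >] = `[< A i !=set0 >].
  apply: asbool_equiv_eq; split=> [[x Kx]|[_ [x Kx _]]]; last by exists x.
  by exists (x ord0 j0), x.
under eq_bigr do rewrite AE.
apply: euler_characteristic_line => [i|i s t u [x [Kx xy] xs] [z [Kz zy] zu] st tu|t].
- apply: continuous_compact; first by apply: continuous_subspaceT; apply: coord_continuous.
  apply: subclosed_compact (Kc i) _; last by move=> x [].
  by apply: closedI => //; apply: compact_closed => //; apply: norm_hausdorff.
- have [us|us] := eqVneq u s.
    by exists x; first by []; rewrite xs; apply: le_anti; rewrite st -us tu.
  have su : 0 < u - s by rewrite subr_gt0 lt_neqAle eq_sym us (le_trans st).
  pose c := (u - t) / (u - s).
  exists (c *: x + (1 - c) *: z).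
    split.
      apply: Kconv => //; first by rewrite divr_ge0 ?subr_ge0 // (le_trans st).
      by rewrite ler_pdivrMr // mul1r lerD2l lerN2.
    by move=> k jk; rewrite !mxE xy // zy // -mulrDl addrC subrK mul1r.
  rewrite !mxE xs zu /c; field; exact: lt0r_neq0.
- pose y' : 'rV[R]_n := \row_k if k == j0 then t else y ord0 k.
  rewrite -[RHS](IHj (ltnW ltj) y'); apply: eq_bigr => i _; congr (_ * (nat_of_bool _)%:R).
  apply: asbool_equiv_eq; split=> [[x [Kx xy] xt]|[x [Kx xy]]].
    exists x; split=> // k; rewrite mxE; case: eqVneq => [->//|kj] jk.
    by apply: xy; rewrite ltn_neqAle jk andbT eq_sym.
  exists x; last by rewrite xy // mxE eqxx.
  split=> // k jk; rewrite xy; last exact: ltnW.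
  by rewrite mxE; case: eqP jk => // ->; rewrite ltnn.
Qed.

End EulerCharacteristic.

(** * Ranks along a flag *)

(** Extend a basis of [X 0] successively to bases of the larger sets. *)
Lemma greedy_base (T : finType) (M : matroid T) (X : nat -> {set T}) m :
  (forall k, X k \subset X k.+1) ->
  exists2 B, B \in bases M & forall k, (k <= m)%N -> #|B :&: X k| = rank M (X k).
Proof.
move=> Xmono.
have sub i j : (i <= j)%N -> X i \subset X j.
  elim: j => [|j IHj]; first by rewrite leqn0 => /eqP->.
  rewrite leq_eqVlt => /orP[/eqP->//|/IHj/subset_trans]; apply; exact: Xmono.
have [I [iI sI cI]] : exists I, [/\ indep M I, I \subset X m &
    forall k, (k <= m)%N -> #|I :&: X k| = rank M (X k)].
  elim: m => [|m [I [iI sI cI]]].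
    have [I [iI sI cI]] := rank_basis M (X 0%N); exists I; split=> // k.
    by rewrite leqn0 => /eqP->; rewrite (setIidPl sI).
  have sIm := subset_trans sI (Xmono m).
  have [J [iJ sIJ sJ cJ]] := indep_extend_rank iI sIm.
  exists J; split=> // k; rewrite leq_eqVlt => /orP[/eqP->|lek].
    by rewrite (setIidPl sJ).
  apply/eqP; rewrite eqn_leq -{2}(cI k lek) subset_leq_card ?setSI // andbT.
  by apply: card_le_rank (subsetIr _ _); apply: indepS iJ; apply: subsetIl.
have [B [iB sIB _ cB]] := indep_extend_rank iI (subsetT I).
have BM : B \in bases M by rewrite basesE iB cB eqxx.
exists B => // k lek; apply/eqP; rewrite eqn_leq card_baseI //= -(cI k lek).
by rewrite subset_leq_card // setSI.
Qed.

Section FlagValuations.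
Variables (R : realType) (T : finType).
Variables (n : nat) (N : 'I_n -> matroid T) (a : 'I_n -> int).
Hypothesis rel : polytope_relation R N a.
Variables (X : nat -> {set T}) (m : nat).
Hypothesis X_mono : forall k, X k \subset X k.+1.

Local Open Scope classical_set_scope.

Let point (v : 'rV[R]_#|T|) : {ffun T -> R} := [ffun e => v ord0 (enum_rank e)].

Let pointE (x : {ffun T -> R}) : point (\row_k x (enum_val k)) = x.
Proof. by apply/ffunP => e; rewrite ffunE mxE enum_rankK. Qed.

Let mass_continuous (A : {set T}) : continuous (fun v => mass (point v) A).
Proof.
rewrite /mass; under eq_fun do under eq_bigr do rewrite ffunE.
apply: continuous_big => [|e _]; first exact: add_continuous.
exact: coord_continuous.
Qed.

Let mass_convex v w (s : R) (A : {set T}) : mass (point (s *: v + (1 - s) *: w)) A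
  = s * mass (point v) A + (1 - s) * mass (point w) A.
Proof.
by rewrite /mass !mulr_sumr -big_split; apply: eq_bigr => e _; rewrite !ffunE !mxE.
Qed.

Let slice (s : 'I_m -> nat) i : set 'rV[R]_#|T| := [set v | base_polytope (N i) (point v)
  /\ forall k : 'I_m, (s k)%:R <= mass (point v) (X k)].

Let slice_compact s i : compact (slice s i).
Proof.
pose cube := [set v : 'rV[R]_#|T| | forall k, (`[0, 1]%classic : set R) (v ord0 k)].
have cube_compact : compact cube.
  exact: (@rV_compact R #|T| (fun=> `[0, 1]%classic) (fun=> @segment_compact R 0 1)).
have half_closed A c : topology_structure.closed [set v | mass (point v) A <= c].
  exact: ((continuous_closedP _).1 (@mass_continuous A) _ (@closed_le _ c)).
have half_closed' A c : topology_structure.closed [set v | c <= mass (point v) A].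
  exact: ((continuous_closedP _).1 (@mass_continuous A) _ (@closed_ge _ c)).
have -> : slice s i = cube `&`
   (\bigcap_(A in [set: {set T}]) [set v | mass (point v) A <= (rank (N i) A)%:R] `&`
   ([set v | (rank (N i) [set: T]%SET)%:R <= mass (point v) [set: T]%SET] `&`
    \bigcap_(k in [set: 'I_m]) [set v | (s k)%:R <= mass (point v) (X k)])).
  apply/seteqP; split=> [v [/base_polytope_mass[x0 le xT] sv]|v].
    split.
      move=> k; rewrite /= in_itv /=; have := x0 (enum_val k).
      have := le [set enum_val k]%SET; rewrite /mass big_set1 ffunE enum_valK => h ->.
      by apply: le_trans h _; rewrite lern1 (leq_trans (rank_card _ _)) ?cards1.
    split; first by move=> A _; apply: le.
    by split; [rewrite /= xT|move=> k _; apply: sv].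
  move=> [vc [le [ge sv]]]; split; last by move=> k; apply: sv.
  apply: base_polytope_rank; split=> [e|A|]; last 1 first.
  - by apply: le_anti; rewrite ge andbT; apply: le.
  - by rewrite ffunE; have := vc (enum_rank e); rewrite /= in_itv => /andP[].
  - exact: le.
apply: compact_closedI => //; apply: closedI; first by apply: closed_bigI => A _.
by apply: closedI => //; apply: closed_bigI.
Qed.

Let slice_convex s i : convex_space (slice s i).
Proof.
move=> v w t [Pv sv] [Pw sw] t0 t1; have t1' : 0 <= 1 - t by rewrite subr_ge0.
split.
  apply: (base_polytope_convex t0 t1' _ _ Pv Pw); first by rewrite addrC subrK.
  by move=> e; rewrite !ffunE !mxE.
move=> k; rewrite mass_convex; have := ler_wpM2l t0 (sv k); have := ler_wpM2l t1' (sw k).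
lra.
Qed.

Let slice_neq0 s i :
  `[< slice s i !=set0 >] = [forall k : 'I_m, (s k <= rank (N i) (X k))%N].
Proof.
apply/asboolP/forallP => [[v [/base_polytope_mass[_ le _] sv]] k|le].
  by rewrite -(ler_nat R) (le_trans (sv k)).
have [B BN cB] := greedy_base (N i) m X_mono.
exists (\row_k indicator_vector R B (enum_val k)); split.
  by rewrite pointE; apply: base_polytope_vertex.
by move=> k; rewrite pointE mass_indicator ler_nat cB // ltnW.
Qed.

(** The Euler characteristic of the part of the base polytope where the flag [X]
    has mass at least [s] is 1 or 0, according to whether the ranks on [X] are at least
    [s]. *)
Lemma flag_rank_ge (s : 'I_m -> nat) :
  \sum_i a i * [forall k : 'I_m, (s k <= rank (N i) (X k))%N]%:R = 0.
Proof.
under eq_bigr do rewrite -slice_neq0.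
apply: euler_characteristic => // v.
have [sv|nsv] := pselect (forall k : 'I_m, (s k)%:R <= mass (point v) (X k)); last first.
  by rewrite big1 // => i _; rewrite asboolF ?mulr0 // => -[_].
rewrite -[RHS](rel (point v)); apply: eq_bigr => i _; rewrite indicator_asbool.
congr (_ * (nat_of_bool _)%:R); apply: asbool_equiv_eq; by split=> [[]|].
Qed.

(** The indicator of [r == p] is that of [p <= r] minus that of [p + 1 <= r]; expanding the
    product over the flag reduces equalities to inequalities. *)
Lemma flag_rank_eq (q : 'I_m -> nat) :
  \sum_i a i * [forall k : 'I_m, rank (N i) (X k) == q k]%:R = 0.
Proof.
have eqE (r p : nat) : (r == p)%:R = \sum_(b : bool) (-1) ^+ b * (p + b <= r)%N%:R :> int.
  rewrite big_bool /= expr1 expr0 mulN1r mul1r addn0 addn1.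
  by case: (ltngtP p r) => //.
transitivity (\sum_(f : {ffun 'I_m -> bool}) (\prod_k (-1) ^+ f k) *
    (\sum_i a i * [forall k : 'I_m, (q k + f k <= rank (N i) (X k))%N]%:R) : int).
  under [RHS]eq_bigr do rewrite mulr_sumr.
  rewrite exchange_big /=; apply: eq_bigr => i _.
  rewrite -prodr_nat_bool; under eq_bigr do rewrite eqE.
  rewrite bigA_distr_bigA mulr_sumr /=; apply: eq_bigr => f _.
  by rewrite big_split /= prodr_nat_bool mulrCA.
by rewrite big1 // => f _; rewrite flag_rank_ge mulr0.
Qed.

End FlagValuations.

(** * Counting flags with given ranks *)

Section FlagCount.
Variables (n : nat) (q : nat -> nat).

(** Complete flags are encoded as linear orders; the numbers of flags with given ranks
    are the coefficients of Derksen's G-invariant. *)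
Definition flags (T : finType) (N : matroid T) : {set {ffun T -> 'I_n}} :=
  [set g : {ffun T -> 'I_n} | [&& #|T| == n, injectiveb g
    & [forall i : 'I_n.+1, rank N (initial g i) == q i]]].

Lemma flags_iso (T U : finType) (M : matroid T) (N : matroid U) :
  isomorphic M N -> #|flags M| = #|flags N|.
Proof.
suff le (V W : finType) (K : matroid V) (L : matroid W) : isomorphic K L ->
    (#|flags L| <= #|flags K|)%N.
  by move=> MN; apply/eqP; rewrite eqn_leq !le //; apply: isomorphic_sym.
move=> KL; have cVW := isomorphic_card KL; have [f [bf fB]] := KL.
pose h (g : {ffun W -> 'I_n}) : {ffun V -> 'I_n} := [ffun t => g (f t)].
have h_inj : injective h.
  move=> g1 g2 /ffunP eh; apply/ffunP => u; have [f' _ f'K] := bf.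
  by have := eh (f' u); rewrite !ffunE f'K.
rewrite -(card_imset _ h_inj) subset_leq_card //; apply/subsetP => _ /imsetP[g + ->].
rewrite !inE => /and3P[cW /injectiveP gI /forallP gq]; apply/and3P; split.
- by rewrite cVW.
- by apply/injectiveP => s t; rewrite !ffunE => /gI/(bij_inj bf).
apply/forallP => i; rewrite -(eqP (gq i)) -(rank_iso bf fB); apply/eqP; congr (rank L _).
have [f' fK f'K] := bf; apply/setP => u; rewrite inE -{1}(f'K u).
by rewrite (mem_imset _ _ (bij_inj bf)) inE ffunE f'K.
Qed.

Lemma flags_valuative (R : realType) (T : finType) m (N : 'I_m -> matroid T)
    (a : 'I_m -> int) :
  polytope_relation R N a -> \sum_(i < m) #|flags (N i)|%:Z * a i = 0.
Proof.
move=> rel.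
have flagsE i : #|flags (N i)|%:Z =
    \sum_(g : {ffun T -> 'I_n} | (#|T| == n) && injectiveb g)
      [forall j : 'I_n.+1, rank (N i) (initial g j) == q j]%:R :> int.
  rewrite -natz -sum1_card natr_sum [LHS]big_mkcond [RHS]big_mkcond; apply: eq_bigr => g _.
  by rewrite inE andbA; case: (_ && injectiveb g) => //=; case: [forall j, _].
under eq_bigr do rewrite flagsE mulr_suml.
rewrite exchange_big big1 //= => g _.
under eq_bigr do rewrite mulrC.
apply: (flag_rank_eq rel (X := fun k => initial g k) _ (fun k => q k)) => k.
by apply/subsetP => t; rewrite !inE => /ltnW.
Qed.

End FlagCount.

Lemma bases_inj (T : finType) : injective (@bases T).
Proof.
move=> [B1 n1 e1] [B2 n2 e2] /= eB; case: B2 / eB n2 e2 => n2 e2.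
by rewrite (Prop_irrelevance n1 n2) (Prop_irrelevance e1 e2).
Qed.

Lemma isomorphic_schubert (T U : finType) (M : matroid T) (N : matroid U) :
  isomorphic M N -> schubert M -> schubert N.
Proof.
case=> f [bf fB] sM X Y.
have [X' ->] := imset_bij_inv bf X; have [Y' ->] := imset_bij_inv bf Y.
by rewrite !(cyclic_flats_iso bf fB) !(imset_bijS bf); apply: sM.
Qed.

Lemma isomorphic_ord (T : finType) (M : matroid T) n : #|T| = n ->
  exists N : matroid 'I_n, isomorphic M N.
Proof.
move=> cT; have [f bf] := card_ord_bij cT; have [N NB] := matroid_transport M bf.
by exists N, f.
Qed.

Section Pairing.
Variables (n : nat) (q : nat -> nat).
Implicit Types (N L : matroid 'I_n) (W : {set {set 'I_n}}) (c : fmatroid -> int).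

Definition representative N : matroid 'I_n :=
  xget (free_matroid _) [set L | isomorphic N L]%classic.

Definition matroid_of W : matroid 'I_n :=
  xget (free_matroid _) [set L | bases L = W]%classic.

Lemma representative_iso N : isomorphic N (representative N).
Proof.
by apply: (@xgetPex _ _ [set L | isomorphic N L]%classic); exists N; apply: isomorphic_refl.
Qed.

Lemma eq_representative N L : isomorphic N L -> representative N = representative L.
Proof.
move=> NL; congr xget; apply/funext => K; apply/propext; split=> [NK|LK].
  exact: isomorphic_trans (isomorphic_sym NL) NK.
exact: isomorphic_trans NL LK.
Qed.

Lemma matroid_of_bases N : matroid_of (bases N) = N.
Proof.
apply: bases_inj; exact: (@xgetPex _ _ [set L | bases L = bases N]%classic (ex_intro _ N erefl)).
Qed.

(** The additive extension of the number of flags from isomorphism classes to their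
    integer combinations: the coefficient of a class is read off at its
    representative.  The sum runs over families of bases, which form a finite type. *)
Definition pairing c : int :=
  \sum_(W | bases (representative (matroid_of W)) == W)
    c (FMatroid (matroid_of W)) * #|flags n q (matroid_of W)|%:Z.

Lemma pairing_is_zmod_morphism : zmod_morphism pairing.
Proof.
by move=> c d; rewrite /pairing -sumrB; apply: eq_bigr => W _; rewrite -mulrBl.
Qed.

HB.instance Definition _ :=
  GRing.isZmodMorphism.Build (fmatroid -> int) int pairing pairing_is_zmod_morphism.

Lemma pairing_iso_class (T : finType) (M : matroid T) :
  pairing (iso_class M) = #|flags n q M|%:Z.
Proof.
have [cT|cT] := eqVneq #|T| n; last first.
  rewrite (_ : flags n q M = set0); last by apply/setP => g; rewrite !inE (negPf cT).
  rewrite cards0 /pairing big1 // => W _; rewrite /iso_class asboolF ?mul0r //.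
  by move=> /isomorphic_card; rewrite card_ord => /eqP; rewrite (negPf cT).
have [N MN] := isomorphic_ord M cT.
set L := representative N; have NL : isomorphic N L := representative_iso N.
have ML := isomorphic_trans MN NL.
rewrite /pairing (bigD1 (bases L)) /=; last first.
  by rewrite matroid_of_bases -(eq_representative NL).
rewrite matroid_of_bases big1 => [|W /andP[/eqP cW WL]].
  by rewrite addr0 /iso_class asboolT // mul1r (flags_iso n q ML).
rewrite /iso_class asboolF ?mul0r //= => MW; case/eqP: WL; rewrite -cW.
congr bases; rewrite /L; apply: eq_representative.
exact: isomorphic_trans (isomorphic_sym MW) MN.
Qed.

Lemma pairing_relator (R : realType) r : zspan (@valuative_relator R) r -> pairing r = 0.
Proof.
elim=> [|_ [T [m [N [a [rel ->]]]]]|u v _ pu _ pv].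
- exact: raddf0.
- rewrite raddf_sum /= -[RHS](flags_valuative n q rel); apply: eq_bigr => i _.
  by rewrite raddfMz /= pairing_iso_class -mulrzr intz.
- by rewrite raddfB /= pu pv subrr.
Qed.

End Pairing.

(** * Schubert coordinates *)

Section Spans.
Variables (V : zmodType) (G : set V).

Lemma zspanN v : zspan G v -> zspan G (- v).
Proof. by move=> Gv; rewrite -sub0r; apply: zspanB Gv; apply: zspan0. Qed.

Lemma zspanD u v : zspan G u -> zspan G v -> zspan G (u + v).
Proof. by move=> Gu Gv; rewrite -[v]opprK; apply/zspanB/zspanN. Qed.

Lemma zspan_sum (I : finType) (P : pred I) (F : I -> V) :
  (forall i, P i -> zspan G (F i)) -> zspan G (\sum_(i | P i) F i).
Proof. by move=> GF; apply: big_ind => //; [apply: zspan0|apply: zspanD]. Qed.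

Lemma zspanMz v (m : int) : zspan G v -> zspan G (v *~ m).
Proof.
move=> Gv; have GvN k : zspan G (v *+ k).
  by elim: k => [|k IHk]; rewrite ?mulr0n ?mulrS; [apply: zspan0|apply: zspanD].
by case: m => k; [apply: GvN|apply/zspanN/GvN].
Qed.

End Spans.

Lemma mulrz_fct (X : Type) (f : X -> int) (m : int) x : (f *~ m) x = f x *~ m.
Proof.
have natE k : (f *+ k) x = f x *+ k by elim: k => [|k IHk] //; rewrite !mulrS -IHk.
case: m => k; first exact: natE.
by rewrite -[RHS]/(- (f x *+ k.+1)) -natE.
Qed.

Lemma iso_class_eq (T U : finType) (M : matroid T) (N : matroid U) :
  isomorphic M N -> iso_class M = iso_class N.
Proof.
move=> MN; apply/funext => L; congr (nat_of_bool _)%:R; apply: asbool_equiv_eq.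
split=> [ML|NL]; last exact: isomorphic_trans NL.
exact: isomorphic_trans (isomorphic_sym MN) ML.
Qed.

Lemma schubert_span c : zspan schubert_class c ->
  (forall N L : fmatroid, isomorphic N L -> c N = c L) /\
  (forall N : fmatroid, c N != 0 -> schubert N).
Proof.
elim=> [|_ [T [S [Ss ->]]]|u v _ [u1 u2] _ [v1 v2]].
- by split=> // N; rewrite eqxx.
- split=> [N L NL|N].
    congr (nat_of_bool _)%:R; apply: asbool_equiv_eq.
    split=> [SN|SL]; first exact: isomorphic_trans NL.
    exact: isomorphic_trans SL (isomorphic_sym NL).
  rewrite /iso_class; case: asboolP => [SN _|]; last by rewrite eqxx.
  exact: isomorphic_schubert SN Ss.
- split=> [N L NL|N]; first by rewrite !fctE (u1 N L) // (v1 N L).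
  rewrite !fctE; have [uN|/u2//] := eqVneq (u N) 0.
  by rewrite uN sub0r oppr_eq0 => /v2.
Qed.

(** Along an adapted order [g] the ranks of a Schubert matroid are as small
    as possible; a Schubert matroid [N] of minimal total rank along its adapted order
    thus is, up to isomorphism, the only one in the combination to have flags with the
    ranks of [N] along [g], and pairing with the number of these flags isolates its
    coefficient. *)
Lemma schubert_independent (R : realType) c :
  zspan schubert_class c -> zspan (@valuative_relator R) c -> c = 0.
Proof.
move=> /schubert_span[c_iso c_sch] rel; apply/funext => -[n N0]; apply/eqP/negPn/negP => cN0.
(* A matroid of least total rank among those with nonzero coefficient. *)
pose cost k := `[< exists N : matroid 'I_n, c (FMatroid N) != 0 /\
  exists2 g : {ffun 'I_n -> 'I_n}, adapted N g &
    k = (\sum_(i < n.+1) rank N (initial g i))%N >].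
have ex_cost : exists k, cost k.
  have [g adg] := adapted_exists (card_ord n) (c_sch _ cN0).
  by eexists; apply/asboolP; exists N0; split; last by exists g.
case: (ex_minnP ex_cost) => k /asboolP[N [cN [g adg kE]]] mink.
pose q i := rank N (initial g i).
have := pairing_relator n q rel; apply/eqP.
have NL := representative_iso N; set L := representative N in NL.
rewrite /pairing (bigD1 (bases L)) /=; last first.
  by rewrite matroid_of_bases -(eq_representative NL).
rewrite matroid_of_bases big1 => [|W /andP[/eqP cW WL]].
  rewrite addr0 mulf_neq0 //; first by rewrite -(c_iso (FMatroid N)).
  rewrite -(flags_iso n q NL) -[0]/(Posz 0) eqz_nat cards_eq0; apply/set0Pn; exists g.
  by rewrite inE card_ord eqxx /=; apply/andP; split; [apply/injectiveP; case: adg|apply/forallP].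
set K := matroid_of W in cW *; apply/eqP; apply: contraNT WL; rewrite mulf_eq0 negb_or.
case/andP=> cK; rewrite -[0]/(Posz 0) eqz_nat cards_eq0 => /set0Pn[h].
rewrite inE card_ord eqxx /= => /andP[/injectiveP hI /forallP hq].
have [f adf] := adapted_exists (card_ord n) (c_sch _ cK).
have le (i : 'I_n.+1) : (rank K (initial f i) <= q i)%N.
  rewrite -(eqP (hq i)); have := adapted_rank (card_ord n) (initial h i) adf.
  by rewrite (card_initial (card_ord n) hI) // -ltnS.
have kK : (k <= \sum_(i < n.+1) rank K (initial f i))%N.
  by apply: mink; apply/asboolP; exists K; split=> //; exists f.
have eqr (i : 'I_n.+1) : rank K (initial f i) = q i.
  apply/eqP; rewrite eqn_leq le /= leqNgt; apply/negP => lt.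
  move: kK; rewrite kE leqNgt => /negP; apply.
  rewrite (bigD1 i) //= [X in (_ < X)%N](bigD1 i) //= -addSn leq_add //.
  by apply: leq_sum => j _; apply: le.
rewrite -cW; apply/eqP; congr bases; rewrite /L; apply: eq_representative.
apply: (profile_isomorphic (card_ord n) (card_ord n) adf adg) => i lei.
exact: (eqr (Ordinal (lei : (i < n.+1)%N))).
Qed.

Theorem theorem3p2 (R : realType) (T : finType) (M : matroid T)
    (Ml : forall e, ~~ loop M e) (Mc : forall e, ~~ coloop M e)
    (P : {set {set {set T}}}) (HP : condensation M P) :
  let K := configuration_of Ml Mc HP in
  (forall (A : zmodType) (Phi : forall U : finType, matroid U -> A),
     valuative_invariant R Phi ->
     Phi T M = \sum_(k < #|block K|)
       \sum_(B : {ffun 'I_k.+1 -> block K} | block_chain B)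
         Phi _ (Sch B) *~ chain_coeff B)
  /\
  (forall c : fmatroid -> int,
     schubert_coordinates R M c <-> c = schubert_coeff K).
Proof.
move=> K; have [n [N [a [rel sumE]]]] := flat_chain_relation R Ml Mc HP.
split=> [A Phi [Phi_iso Phi_val]|c].
  rewrite (sum_block_chains Ml Mc HP Phi_iso); apply/eqP.
  by rewrite -subr_eq0 -(sumE A (Phi T)) Phi_val.
have coeffE : schubert_coeff K = \sum_(k < #|block K|)
    \sum_(F : {ffun 'I_k.+1 -> {set T}} | flat_chain M F)
      iso_class (flat_schubert M F) *~ flat_chain_coeff M F.
  rewrite -(sum_block_chains Ml Mc HP (Phi := @iso_class)); last exact: iso_class_eq.
  apply/funext => S; rewrite /schubert_coeff fct_sumE; apply: eq_bigr => k _.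
  rewrite fct_sumE big_mkcondr; apply: eq_bigr => B _.
  by rewrite mulrz_fct /iso_class; case: asboolP => _; rewrite ?mul0rz // -mulrzr intz mul1r.
have coeff_span : zspan schubert_class (schubert_coeff K).
  rewrite coeffE; apply: zspan_sum => k _; apply: zspan_sum => F FC.
  apply/zspanMz/zspan_gen; exists T, (flat_schubert M F); split=> //.
  exact: flat_schubertP.
have coeff_rel : zspan (@valuative_relator R) (iso_class M - schubert_coeff K).
  apply: zspan_gen; exists T, n, N, a; split=> //.
  by rewrite (sumE _ (@iso_class T)) coeffE.
split=> [[c_span c_rel]|->//].
apply/eqP; rewrite -subr_eq0; apply/eqP; apply: (schubert_independent (R := R)).
  exact: zspanB.
have -> : c - schubert_coeff K = (iso_class M - schubert_coeff K) - (iso_class M - c).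
  by rewrite opprB [RHS]addrC addrA subrK.
exact: zspanB.
Qed.
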